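(* Let $\mathbf A=(a_{ij})\in\mathbb H^{n\times n}$ have index $k$, with $\operatorname{rank}\mathbf A^{k+1}=\operatorname{rank}\mathbf A^{k}=r\le n$, and let $\mathbf b=(b_i)\in\mathbb H^{1\times n}$ be a constant row vector. Consider the particular solution $\mathbf X(t)=(x_i(t))_{i=1}^n$ (a row) of the system $\mathbf x'(t)=\mathbf x(t)\mathbf A+\mathbf b$ given by $$\mathbf X(t)=-\mathbf b\mathbf A^{D}+(\mathbf b-\mathbf b\mathbf A\mathbf A^{D})t+\frac1{2}(\mathbf b\mathbf A-\mathbf b\mathbf A^{2}\mathbf A^{D})t^{2}+\dots+\frac1{k!}(\mathbf b\mathbf A^{k-1}-\mathbf b\mathbf A^{k}\mathbf A^{D})t^{k}.$$ Write $\check{\mathbf b}^{(l)}=(\check b^{(l)}_i):=\mathbf b\mathbf A^{l}$ for $l=0,\dots,2k$ (so $\check{\mathbf b}^{(0)}=\mathbf b$). Then for all $i=1,\dots,n$ $$x_i(t)=-R_i^{(0)}+\sum_{m=1}^{k}\frac{1}{m!}\left(\check b_i^{(m-1)}-R_i^{(m)}\right)t^{m},$$ where the $R_i^{(m)}$ ($m=0,\dots,k$) are given as follows. (i) When $\mathbf A$ is Hermitian, $$R_i^{(m)}=\frac{\sum_{\alpha\in I_{r,n}\{i\}}\operatorname{rdet}_i\left(\left(\mathbf A^{k+1}\right)_{i.}\left(\check{\mathbf b}^{(k+m)}\right)\right)_{\alpha}^{\alpha}}{\sum_{\alpha\in I_{r,n}}\left|\left(\mathbf A^{k+1}\right)_{\alpha}^{\alpha}\right|}.$$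 (ii) When $\mathbf A$ is arbitrary, $$R_i^{(m)}=\frac{\sum_{s=1}^{n}\left(\sum_{\alpha\in I_{r,n}\{s\}}\operatorname{rdet}_s\left(\left(\mathbf A^{2k+1}(\mathbf A^{2k+1})^{*}\right)_{s.}\left(\check{\mathbf d}^{(m)}\right)\right)_{\alpha}^{\alpha}\right)a_{si}^{(k)}}{\sum_{\alpha\in I_{r,n}}\left|\left(\mathbf A^{2k+1}(\mathbf A^{2k+1})^{*}\right)_{\alpha}^{\alpha}\right|},$$ where $\check{\mathbf d}^{(l)}:=\mathbf b\mathbf A^{k+l}(\mathbf A^{2k+1})^{*}\in\mathbb H^{1\times n}$ for $l=0,\dots,k$, and $a_{si}^{(k)}$ is the $(s,i)$ entry of $\mathbf A^k$.
   Context: $\mathbb H$ is the real quaternion skew field; $\mathbf A^{*}$ is the conjugate transpose; $\mathbf A$ is Hermitian if $\mathbf A^*=\mathbf A$. Derivatives of functions $\mathbb R\to\mathbb H$ (and of matrix-valued functions) are taken componentwise. Index and Drazin inverse: $k=\operatorname{Ind}\mathbf A$ is the smallest positive integer with $\operatorname{rank}\mathbf A^{k+1}=\operatorname{rank}\mathbf A^{k}$. The Drazin inverse $\mathbf A^D$ is the unique matrix $\mathbf X$ with $\mathbf X\mathbf A\mathbf X=\mathbf X$, $\mathbf A\mathbf X=\mathbf X\mathbf A$, $\mathbf A^{k+1}\mathbf X=\mathbf A^{k}$. Row determinants: for $\mathbf M=(m_{ij})\in\mathbb H^{n\times n}$ and $i\in\{1,\dots,n\}$, $$\operatorname{rdet}_i\mathbf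 M=\sum_{\sigma\in S_n}(-1)^{n-p}\,(m_{i\,i_{k_1}}m_{i_{k_1}i_{k_1+1}}\cdots m_{i_{k_1+l_1}i})\cdots(m_{i_{k_p}i_{k_p+1}}\cdots m_{i_{k_p+l_p}i_{k_p}}),$$ where $\sigma$ is written as a product of its $p$ disjoint cycles (fixed points included) $\sigma=(i\,i_{k_1}i_{k_1+1}\dots i_{k_1+l_1})(i_{k_2}i_{k_2+1}\dots i_{k_2+l_2})\cdots(i_{k_p}i_{k_p+1}\dots i_{k_p+l_p})$ with $i_{k_2}<i_{k_3}<\dots<i_{k_p}$ and $i_{k_t}<i_{k_t+s}$ for $t=2,\dots,p$, $s=1,\dots,l_t$ (the cycle containing $i$ is the leftmost one; a fixed point $c$ contributes the factor $m_{cc}$). For a Hermitian matrix all row determinants (and all column determinants) coincide and are real; their common value is $\det\mathbf M$. $\mathbf M_{i.}(\mathbf c)$ denotes the matrix obtained from $\mathbf M$ by replacing its $i$th row by the row $\mathbf c$. For $\alpha=\{\alpha_1<\dots<\alpha_r\}\subseteq\{1,\dots,n\}$, $\mathbf M_\alpha^\alpha$ is the principal submatrix with rows and columns indexed by $\alpha$; rows and columns of $\mathbf M_\alpha^\alpha$ keep their original indices, so for $i\in\alpha$, $\operatorname{rdet}_i(\mathbf M)_\alpha^\alpha$ is the row determinant of the submatrix $\mathbf M_\alpha^\alpha$ along the row with original index $i$. For Hermitian $\mathbf M$, $|\mathbf M_\alpha^\alpha|$ is the principal minor $\det\mathbf M_\alpha^\alpha$. $I_{r,n}$ is the set of all $r$-element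 subsets (strictly increasing sequences) of $\{1,\dots,n\}$, and $I_{r,n}\{i\}=\{\alpha\in I_{r,n}: i\in\alpha\}$. *)

(* Defs.v *)
From HB Require Import structures.
From mathcomp Require Import all_boot all_order all_algebra all_fingroup.
From mathcomp Require Import all_classical all_reals all_analysis.
From mathcomp Require Import ring lra.
Import numFieldNormedType.Exports.
Import Order.TTheory GRing.Theory Num.Theory.

Set Implicit Arguments.
Unset Strict Implicit.
Unset Printing Implicit Defensive.

Local Open Scope ring_scope.

(* [Quat a b c d] is a + b i + c j + d k *)
Record quat (R : realFieldType) := Quat { qre : R; qi : R; qj : R; qk : R }.

Section QuaternionSkewField.
Variable R : realFieldType.
Implicit Types x y z : quat R.

Definition tuple_of_quat x := (qre x, qi x, qj x, qk x).
Definition quat_of_tuple (u : R * R * R * R) :=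
  let: (a, b, c, d) := u in Quat a b c d.

Lemma tuple_of_quatK : cancel tuple_of_quat quat_of_tuple.
Proof. by case. Qed.

HB.instance Definition _ := Choice.copy (quat R) (can_type tuple_of_quatK).

Definition addq x y :=
  Quat (qre x + qre y) (qi x + qi y) (qj x + qj y) (qk x + qk y).
Definition oppq x := Quat (- qre x) (- qi x) (- qj x) (- qk x).
Definition zeroq : quat R := Quat 0 0 0 0.
Definition oneq : quat R := Quat 1 0 0 0.
Definition mulq x y :=
  Quat (qre x * qre y - qi x * qi y - qj x * qj y - qk x * qk y)
       (qre x * qi y + qi x * qre y + qj x * qk y - qk x * qj y)
       (qre x * qj y - qi x * qk y + qj x * qre y + qk x * qi y)
       (qre x * qk y + qi x * qj y - qj x * qi y + qk x * qre y).

Lemma addqA : associative addq.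
Proof. by move=> x y z; rewrite /addq /= !addrA. Qed.
Lemma addqC : commutative addq.
Proof.
by move=> x y; rewrite /addq [qre x + _]addrC [qi x + _]addrC
  [qj x + _]addrC [qk x + _]addrC.
Qed.
Lemma add0q : left_id zeroq addq.
Proof. by case=> a b c d; rewrite /addq /= !add0r. Qed.
Lemma addNq : left_inverse zeroq oppq addq.
Proof. by move=> x; rewrite /addq /= !addNr. Qed.

HB.instance Definition _ := GRing.isZmodule.Build (quat R)
  addqA addqC add0q addNq.

Lemma mulqA : associative mulq.
Proof. by move=> x y z; rewrite /mulq /=; congr Quat; ring. Qed.
Lemma mul1q : left_id oneq mulq.
Proof. by case=> a b c d; rewrite /mulq /=; congr Quat; ring. Qed.
Lemma mulq1 : right_id oneq mulq.
Proof. by case=> a b c d; rewrite /mulq /=; congr Quat; ring. Qed.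
Lemma mulqDl : left_distributive mulq +%R.
Proof. by move=> x y z; rewrite /mulq /=; congr Quat => /=; ring. Qed.
Lemma mulqDr : right_distributive mulq +%R.
Proof. by move=> x y z; rewrite /mulq /=; congr Quat => /=; ring. Qed.
Lemma oneq_neq0 : oneq != 0.
Proof. by apply/eqP; case=> /eqP; rewrite oner_eq0. Qed.

HB.instance Definition _ := GRing.Zmodule_isNzRing.Build (quat R)
  mulqA mul1q mulq1 mulqDl mulqDr oneq_neq0.

Definition conjq x := Quat (qre x) (- qi x) (- qj x) (- qk x).
Definition sqnormq x := qre x ^+ 2 + qi x ^+ 2 + qj x ^+ 2 + qk x ^+ 2.
Definition invq x :=
  Quat (qre x / sqnormq x) (- qi x / sqnormq x)
       (- qj x / sqnormq x) (- qk x / sqnormq x).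

Lemma sqnormq_eq0 x : (sqnormq x == 0) = (x == 0).
Proof.
apply/eqP/eqP => [|->]; last by rewrite /sqnormq /= !expr0n /= !addr0.
case: x => a b c d /eqP.
rewrite /sqnormq /= !paddr_eq0 ?addr_ge0 ?sqr_ge0// !sqrf_eq0.
by move=> /andP[/andP[/andP[/eqP-> /eqP->] /eqP->] /eqP->].
Qed.

Lemma mulVq : {in [pred x | x != 0], left_inverse 1 invq *%R}.
Proof.
move=> x; rewrite inE -sqnormq_eq0 /sqnormq => x0.
by rewrite /GRing.mul /= /mulq /invq /sqnormq /=; congr Quat; field.
Qed.
Lemma mulqV : {in [pred x | x != 0], right_inverse 1 invq *%R}.
Proof.
move=> x; rewrite inE -sqnormq_eq0 /sqnormq => x0.
by rewrite /GRing.mul /= /mulq /invq /sqnormq /=; congr Quat; field.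
Qed.
Lemma unitqP x y : y * x = 1 /\ x * y = 1 -> x != 0.
Proof.
case=> + _; apply: contra_eqN => /eqP->.
by rewrite mulr0 eq_sym oner_neq0.
Qed.
Lemma invq_out : {in [predC [pred x | x != 0]], invq =1 id}.
Proof.
move=> x; rewrite !inE negbK => /eqP->.
by rewrite /invq /= !oppr0 !mul0r.
Qed.

(* Hence 0^-1 = 0, and [x / y] is x * y^-1. *)
HB.instance Definition _ := GRing.NzRing_hasMulInverse.Build (quat R)
  mulVq mulqV unitqP invq_out.

Definition qreal (a : R) : quat R := Quat a 0 0 0.

End QuaternionSkewField.

Section QuaternionMatrices.
Variable R : realFieldType.
Local Notation H := (quat R).

Definition adjq m n (A : 'M[H]_(m, n)) : 'M[H]_(n, m) :=
  map_mx (@conjq R) A^T.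

Definition hermitianq n (A : 'M[H]_n) : Prop := adjq A = A.

Definition right_free_cols m n (A : 'M[H]_(m, n)) (S : {set 'I_n}) : Prop :=
  forall c : 'cV[H]_n,
    (forall j, j \notin S -> c j 0 = 0) -> A *m c = 0 -> c = 0.

(* [\rank] is only available over commutative fields.  Over H the rank is the
   maximal number of right linearly independent columns. *)
Definition rankq m n (A : 'M[H]_(m, n)) : nat :=
  \max_(S : {set 'I_n} | `[< right_free_cols A S >]) #|S|.

(* The powers A ^+ k are those of the ring of n x n matrices over H. *)
Definition is_index n (A : 'M[H]_n) (k : nat) : Prop :=
  [/\ (0 < k)%N, rankq (A ^+ k.+1) = rankq (A ^+ k) &
      forall j, (0 < j)%N -> rankq (A ^+ j.+1) = rankq (A ^+ j) -> (k <= j)%N].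

Definition is_drazin n (A : 'M[H]_n) (k : nat) (X : 'M[H]_n) : Prop :=
  [/\ X *m A *m X = X, A *m X = X *m A & A ^+ k.+1 *m X = A ^+ k].

(* m_{i s(i)} m_{s(i) s^2(i)} ... m_{s^l(i) i}, the factors being taken in this
   order along the cycle of s through i *)
Definition cycle_prod n (M : 'M[H]_n) (s : 'S_n) (i : 'I_n) : H :=
  \prod_(x <- traject s i #|porbit s i|) M x (s x).

(* The row determinant, along the row of original index i \in alpha, of the
   principal submatrix of M on alpha.  Rows and columns keep their original
   indices (a full alpha gives rdet_i M itself), so the sum runs over the
   permutations of alpha, i.e. the s in 'S_n fixing every point outside alpha.  The number p of cycles of s counts its
   fixed points in alpha.  The cycle through i comes first; each other cycle
   is opened by its least element c, and these cycles are multiplied by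
   increasing c (the order in which a big operator enumerates 'I_n). *)
Definition rdet_on n (alpha : {set 'I_n}) (i : 'I_n) (M : 'M[H]_n) : H :=
  \sum_(s : 'S_n | perm_on alpha s)
    (-1) ^+ (#|alpha| - #|porbit s @: alpha|) *
    (cycle_prod M s i *
     \prod_(c < n | [&& c \in alpha, c \notin porbit s i &
                        [forall x in porbit s c, (c <= x)%N]])
        cycle_prod M s c).

(* The principal minor of a Hermitian M on alpha: all row determinants of the
   submatrix agree, so any row may be chosen.  The empty minor is 1. *)
Definition pminor n (alpha : {set 'I_n}) (M : 'M[H]_n) : H :=
  if [pick i in alpha] is Some i then rdet_on alpha i M else 1.

Definition repl_row n (M : 'M[H]_n) (i : 'I_n) (c : 'rV[H]_n) : 'M[H]_n :=
  \matrix_(a, j) if a == i then c 0 j else M a j.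

Definition Rherm n (A : 'M[H]_n) (b : 'rV[H]_n) (k r m : nat) (i : 'I_n) : H :=
  (\sum_(alpha : {set 'I_n} | (#|alpha| == r) && (i \in alpha))
      rdet_on alpha i (repl_row (A ^+ k.+1) i (b *m A ^+ (k + m)))) /
  (\sum_(alpha : {set 'I_n} | #|alpha| == r) pminor alpha (A ^+ k.+1)).

Definition Rgen n (A : 'M[H]_n) (b : 'rV[H]_n) (k r m : nat) (i : 'I_n) : H :=
  let B := A ^+ (2 * k).+1 in
  let d := b *m A ^+ (k + m) *m adjq B in
  (\sum_(s < n)
     (\sum_(alpha : {set 'I_n} | (#|alpha| == r) && (s \in alpha))
        rdet_on alpha s (repl_row (B *m adjq B) s d)) * (A ^+ k) s i) /
  (\sum_(alpha : {set 'I_n} | #|alpha| == r) pminor alpha (B *m adjq B)).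

End QuaternionMatrices.

Section DifferentialSystem.
Variable R : realType.
Local Notation H := (quat R).

Definition is_derive_quat (f : R -> H) (t : R) (d : H) : Prop :=
  [/\ is_derive t (1 : R) (fun u => qre (f u)) (qre d),
      is_derive t (1 : R) (fun u => qi (f u)) (qi d),
      is_derive t (1 : R) (fun u => qj (f u)) (qj d) &
      is_derive t (1 : R) (fun u => qk (f u)) (qk d)].

(* x' = x A + b on the whole real line *)
Definition solves_system n (A : 'M[H]_n) (b : 'rV[H]_n) (x : R -> 'rV[H]_n) :
    Prop :=
  forall (t : R) (i : 'I_n),
    is_derive_quat (fun u => x u 0 i) t ((x t *m A + b) 0 i).

End DifferentialSystem.

(* Main.v *)
Require Import Defs.
From HB Require Import structures.
From mathcomp Require Import all_boot all_order all_algebra all_fingroup.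
From mathcomp Require Import ring lra zify.
Import Order.TTheory GRing.Theory Num.Theory.
Local Open Scope ring_scope.
Set Implicit Arguments.
Unset Strict Implicit.
Unset Printing Implicit Defensive.

(** Let [AD] be the Drazin inverse of [A].  Differentiating the polynomial
    solution shifts its coefficients [b A^(m-1) - b A^m AD] by one, and so does
    right multiplication by [A]; the shift closes up because the coefficient
    after the last one is [b (A^k - A^(k+1) AD) = 0].  The real content is that
    the determinant ratios compute [b A^m AD].

    Let [G] be Hermitian over the quaternions ([A^(k+1)] in the Hermitian case,
    [B B*] with [B = A^(2k+1)] in general).  Expanding a row determinant along
    the cycle of its distinguished index gives a sum, over the vertex set of
    that cycle, of a path sum times a determinant of the complementary indices
    ([rdet_on_expand]).  Path sums taken over vertex sets carry all the
    noncommutativity, and three facts about them suffice: a path may be cut at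
    any of its vertices ([hampath_split]), reversing paths is conjugation
    ([hampath_conj]), and hence cycle sums are real and do not depend on where
    the cycle is opened ([cycle_real], [cycle_indep]).  It follows that
    determinants of Hermitian matrices are real and agree along all rows
    ([canon_det_rdet]), and that a row times the cofactors of another row
    vanishes ([row_cofactor0]).

    Let [d_p] be the sum of the principal minors of order [p], and [Q_p] the sum
    of the adjugates of the principal submatrices of order [p], each extended
    by zero.  The cofactor identities combine into
    [Q_(p+1) = d_p - G Q_p] ([adjmx_rec]), the Faddeev-LeVerrier recursion.
    Let [rho] be the last [p] with [d_p <> 0].  As [Q_p = 0] for [p > n], a
    power of [G] annihilates [Q_(rho+1)]; since [G] is Hermitian, [G] itself
    does, that is, [G G Q_rho = d_rho G].  So [G Q_rho / d_rho] is a projection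
    onto the column space of [G].  Its real trace is [rho], because the diagonal
    of [Q_(rho+1)] consists of sums of principal minors, and the real trace of a
    projection is its rank ([retrace_projection]); hence [rho = r].

    The numerator of the ratio is the [i]th entry of [c Q_r], where [c] is the
    substituted row.  When [c = y G] with [y] in the row space of [G], the ratio
    is therefore [y_i].  In the Hermitian case this applies to [y = b A^m AD].
    In the general case it yields a row [w] with [w B B* = b A^(k+m) B*]; hence
    [w B = b A^(k+m)], and [w A^k = w B AD^(k+1) = b A^m AD]. *)

(** * Expansion of row determinants along the distinguished cycle *)

Section Hampath.
Variables (R : realFieldType) (n : nat).
Local Notation H := (quat R).
Implicit Types (M G : 'M[H]_n) (X Y Z alpha : {set 'I_n}) (i j l m : 'I_n).

(** Sum, over the simple paths from [j] to [i] whose vertex set is exactly [X],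
    of the products of the entries of [M] along the edges, in this order.  The
    natural number is the recursion depth: [#|X|] steps are enough. *)
Fixpoint hampath_rec M (N : nat) X j i : H :=
  if j == i then (X == [set i])%:R
  else if N is N'.+1 then
    if j \in X then \sum_m M j m * hampath_rec M N' (X :\ j) m i else 0
  else 0.

Definition hampath M X j i := hampath_rec M #|X| X j i.

Lemma hampath_diag M X i : hampath M X i i = (X == [set i])%:R.
Proof. by rewrite /hampath; case: #|X| => [|N] /=; rewrite eqxx. Qed.

Lemma hampathE M X j i : j != i -> j \in X ->
  hampath M X j i = \sum_m M j m * hampath M (X :\ j) m i.
Proof. by move=> ji jX; rewrite /hampath (cardsD1 j X) jX add1n /= jX (negbTE ji). Qed.

Lemma hampath_outl M X j i : j \notin X -> hampath M X j i = 0.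
Proof.
move=> jX; have [ji|ji] := eqVneq j i.
  rewrite ji hampath_diag; case: eqP => // XE.
  by move: jX; rewrite XE ji inE eqxx.
by rewrite /hampath; case: #|X| => [|N] /=; rewrite (negbTE ji) ?(negbTE jX).
Qed.

Lemma hampath_outr M X j i : i \notin X -> hampath M X j i = 0.
Proof.
have [N] := ubnP #|X|; elim: N X j => // N IH X j cX iX.
have [jX|jX] := boolP (j \in X); last exact: hampath_outl.
have ji : j != i by apply: contraNneq iX => <-.
rewrite hampathE// big1// => m _; rewrite IH ?mulr0//.
  by move: cX; rewrite (cardsD1 j X) jX.
by rewrite inE negb_and iX orbT.
Qed.

(** A path stops as soon as it reaches [i], so it never leaves through row [i]:
    this is why path sums are insensitive to replacing that row. *)
Lemma eq_hampath M G X j i : (forall a b, a != i -> M a b = G a b) ->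
  hampath M X j i = hampath G X j i.
Proof.
move=> MG; have [N] := ubnP #|X|; elim: N X j => // N IH X j cX.
have [->|ji] := eqVneq j i; first by rewrite !hampath_diag.
have [jX|jX] := boolP (j \in X); last by rewrite !hampath_outl.
rewrite !hampathE//; apply: eq_bigr => m _; rewrite MG// IH//.
by move: cX; rewrite (cardsD1 j X) jX.
Qed.

Definition is_cycle_on X i (s : 'S_n) := perm_on X s && (porbit s i == X).

Lemma eq_traject_on (s t : 'S_n) x N :
  {in traject t x N, s =1 t} -> traject s x N = traject t x N.
Proof.
elim: N x => //= N IH x st; rewrite st ?mem_head//.
by rewrite IH// => y yt; apply: st; rewrite inE yt orbT.
Qed.

(** Precomposing a cycle [i -> j -> s j -> ...] with the transposition of [i]
    and [j] short-circuits it into [i -> s j -> ...] and fixes [j].  Together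
    with its converse below, this lets sums over cyclic permutations follow the
    recursion that defines [hampath]. *)
Lemma cycle_remove X i j (s : 'S_n) : i \in X -> j \in X -> j != i ->
  is_cycle_on X i s -> s i = j -> is_cycle_on (X :\ j) i (tperm i j * s).
Proof.
move=> iX jX ji /andP[sX /eqP oX] sij.
set t := (tperm i j * s)%g.
have tj : t j = j by rewrite /t permM tpermR.
have tX : perm_on (X :\ j) t.
  rewrite /perm_on; apply/subsetP => x; rewrite !inE => tx.
  have -> : x != j by apply: contraNneq tx => ->; rewrite tj.
  apply: contraNT tx => xX; rewrite /t permM tpermD; first last.
  - by apply: contraNneq xX => <-.
  - by apply: contraNneq xX => <-.
  by rewrite (out_perm sX).
apply/andP; split=> //; rewrite eqEsubset; apply/andP; split.
  apply/subsetP => _ /porbitP[e ->]; elim: e => [|e IH].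
    by rewrite expg0 perm1 !inE eq_sym ji.
  by rewrite expgSr permM (perm_closed _ tX).
have cX : #|X| = #|X|.-2.+2.
  by rewrite (cardsD1 i) iX (cardsD1 j) !inE ji jX.
have := uniq_traject_porbit s i; have := porbit_traject s i.
rewrite oX cX /= sij => memX /andP[+ /andP[jT uT]].
rewrite inE negb_or => /andP[_ iT].
have trE : traject t (s j) #|X|.-2 = traject s (s j) #|X|.-2.
  apply: eq_traject_on => x xs; rewrite /t permM tpermD //.
    by apply: contraNneq iT => {1}->.
  by apply: contraNneq jT => {1}->.
apply/subsetP => x; rewrite !inE => /andP[xj]; rewrite memX !inE (negbTE xj) /=.
case/orP => [/eqP->|]; first exact: porbit_id.
rewrite -trE => /trajectP[e _ ->].
have <- : t i = s j by rewrite /t permM tpermL.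
by rewrite -permX -permM -expgS mem_porbit.
Qed.

Lemma cycle_insert X i j (t : 'S_n) : i \in X -> j \in X -> j != i ->
  is_cycle_on (X :\ j) i t ->
  is_cycle_on X i (tperm i j * t) && ((tperm i j * t)%g i == j).
Proof.
move=> iX jX ji /andP[tX /eqP oX].
set s := (tperm i j * t)%g.
have tj : t j = j by rewrite (out_perm tX) // !inE eqxx.
have sij : s i = j by rewrite /s permM tpermL.
have sjE : s j = t i by rewrite /s permM tpermR.
have sX : perm_on X s.
  rewrite /perm_on; apply/subsetP => x; rewrite !inE => sx.
  apply: contraNT sx => xX; rewrite /s permM tpermD; first last.
  - by apply: contraNneq xX => <-.
  - by apply: contraNneq xX => <-.
  by rewrite (out_perm tX)// !inE negb_and xX orbT.
rewrite sij eqxx andbT; apply/andP; split=> //.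
rewrite eqEsubset; apply/andP; split.
  apply/subsetP => _ /porbitP[e ->]; elim: e => [|e IH].
    by rewrite expg0 perm1.
  by rewrite expgSr permM (perm_closed _ sX).
have cX : #|X :\ j| = #|X :\ j|.-1.+1 by rewrite (cardsD1 i) !inE eq_sym ji iX.
have := uniq_traject_porbit t i; have := porbit_traject t i.
rewrite oX cX /= => memX /andP[iT uT].
have trE : traject s (t i) #|X :\ j|.-1 = traject t (t i) #|X :\ j|.-1.
  apply: eq_traject_on => x xs; rewrite /s permM tpermD //.
    by apply: contraNneq iT => {1}->.
  by apply/eqP => jx; have := memX x; rewrite [in RHS]inE xs orbT -jx !inE eqxx.
apply/subsetP => x xX; have [->|xj] := eqVneq x j.
  by rewrite -sij; exact: (mem_porbit s 1).
have := memX x; rewrite !inE xj xX => /esym/orP[/eqP->|]; first exact: porbit_id.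
rewrite -trE => /trajectP[e _ ->].
by rewrite -sjE -sij -permX -!permM -expgS -expgS mem_porbit.
Qed.

(** Induction on the length of the cycle: the vertex [j] that follows [i] is
    removed by the transposition of [i] and [j]. *)
Lemma sum_cycles_from M X i j N : i \in X -> #|X| = N.+1 ->
  \sum_(s : 'S_n | is_cycle_on X i s && (s i == j))
     \prod_(x <- traject s j N) M x (s x) = hampath M X j i.
Proof.
elim: N X j => [|N IH] X j iX cX.
  have /eqP/cards1P[a XE] := cX.
  move: iX; rewrite XE inE => /eqP ->{i}.
  have [<-|ji] := eqVneq j a.
    rewrite hampath_diag eqxx (big_pred1 1%g) ?big_nil// => s /=.
    apply/idP/eqP => [/andP[/andP[s1 _] _]|->].
      by apply: (perm_on_id s1); rewrite cards1.
    rewrite perm1 eqxx andbT /is_cycle_on perm_on1 /=.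
    rewrite eqEsubset; apply/andP; split.
      by apply/subsetP => _ /porbitP[e ->]; rewrite expg1n perm1 inE.
    by rewrite sub1set porbit_id.
  rewrite hampath_outl ?inE// big_pred0// => s; apply/negbTE/negP.
  case/andP=> /andP[/perm_closed sX _] /eqP sj.
  by have := sX a; rewrite sj !inE eqxx (negbTE ji).
have [jX|jX] := boolP (j \in X); last first.
  rewrite hampath_outl// big_pred0// => s; apply/negbTE/negP.
  case/andP=> /andP[/perm_closed sX _] /eqP sj.
  by have := sX i; rewrite sj iX (negbTE jX).
have [ji|ji] := eqVneq j i.
  rewrite ji hampath_diag (_ : _ == _ = false); last first.
    by apply/eqP => XE; move: cX; rewrite XE cards1.
  rewrite big_pred0// => s; apply/negbTE/negP => /andP[/andP[_ /eqP oX] /eqP si].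
  have : X \subset [set i].
    rewrite -oX; apply/subsetP => _ /porbitP[e ->]; rewrite inE.
    by elim: e => [|e IHe]; rewrite ?expg0 ?perm1// expgSr permM (eqP IHe) si.
  by move/subset_leq_card; rewrite cX cards1.
have cXj : #|X :\ j| = N.+1 by move: cX; rewrite (cardsD1 j) jX => -[].
have iXj : i \in X :\ j by rewrite !inE eq_sym ji.
rewrite hampathE//.
rewrite (reindex_inj (mulgI (tperm i j))) /=.
rewrite (eq_bigl (is_cycle_on (X :\ j) i)); last first.
  move=> s /=; apply/idP/idP; last exact: cycle_insert.
  case/andP=> sc /eqP si.
  by have := cycle_remove iX jX ji sc si; rewrite mulgA tperm2 mul1g.
rewrite (partition_big (fun s : 'S_n => s i) xpredT)//=.
apply: eq_bigr => m _; rewrite -(IH _ _ iXj cXj) big_distrr /=.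
apply: eq_bigr => t /andP[tc /eqP tim].
rewrite big_cons permM tpermR tim; congr (_ * _).
have tX : perm_on (X :\ j) t by case/andP: tc.
have := uniq_traject_porbit t i; have := porbit_traject t i.
case/andP: tc => _ /eqP ->; rewrite cXj /= tim => memX /andP[iT _].
have st : {in traject t m N, (tperm i j * t)%g =1 t}.
  move=> x xs; rewrite permM tpermD //.
    by apply: contraNneq iT => {1}->.
  by apply/eqP => jx; have := memX x; rewrite [in RHS]inE xs orbT -jx !inE eqxx.
by rewrite (eq_traject_on st); apply: eq_big_seq => x /st ->.
Qed.

Lemma sum_cycle_prod M X i : i \in X ->
  \sum_(s : 'S_n | is_cycle_on X i s) cycle_prod M s i =
  \sum_j M i j * hampath M X j i.
Proof.
move=> iX; have cX : #|X| = #|X|.-1.+1 by rewrite (cardsD1 i) iX.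
rewrite (partition_big (fun s : 'S_n => s i) xpredT)//=.
apply: eq_bigr => j _; rewrite -(sum_cycles_from _ _ iX cX) big_distrr /=.
apply: eq_bigr => s /andP[/andP[_ /eqP oX] /eqP sij].
by rewrite /cycle_prod oX cX /= big_cons sij.
Qed.


Section ClosedSet.
Variables (s t : 'S_n) (X : {set 'I_n}).
Hypotheses (tX : {homo t : y / y \in X}) (st : {in X, s =1 t}).

Lemma eq_iter_in x e : x \in X -> (s ^+ e)%g x = (t ^+ e)%g x /\ (t ^+ e)%g x \in X.
Proof.
move=> xX; elim: e => [|e [IH IHX]]; first by rewrite !expg0 !perm1.
by rewrite !expgSr !permM IH st//; split=> //; exact: tX.
Qed.

Lemma eq_porbit_in x : x \in X -> porbit s x = porbit t x.
Proof.
move=> xX; apply/setP => y; apply/porbitP/porbitP => -[e ->]; exists e;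
  by have [-> _] := eq_iter_in e xX.
Qed.

Lemma porbit_sub_in x : x \in X -> porbit t x \subset X.
Proof.
by move=> xX; apply/subsetP => _ /porbitP[e ->]; have [] := eq_iter_in e xX.
Qed.

Lemma eq_cycle_prod_in M x : x \in X -> cycle_prod M s x = cycle_prod M t x.
Proof.
move=> xX; rewrite /cycle_prod eq_porbit_in//.
have sub N : {subset traject t x N <= X}.
  move=> y /trajectP[e _ ->]; rewrite -permX.
  by have [] := eq_iter_in e xX.
rewrite (eq_traject_on (t := t)); last by move=> y /sub; exact: st.
by apply: eq_big_seq => y /sub /st ->.
Qed.
End ClosedSet.

Lemma perm_on_closed_homo (t : 'S_n) X : perm_on X t -> {homo t : y / y \in X}.
Proof. by move=> tX y; rewrite (perm_closed _ tX). Qed.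

Section DisjointProduct.
Variables (X Y : {set 'I_n}) (s1 s2 : 'S_n).
Hypotheses (XY : [disjoint X & Y]) (s1X : perm_on X s1) (s2Y : perm_on Y s2).

Lemma mul_perm_onl : {in X, (s1 * s2)%g =1 s1}.
Proof.
move=> x xX; rewrite permM (out_perm s2Y)//.
by rewrite (disjointFr XY)// (perm_closed _ s1X).
Qed.

Lemma mul_perm_onr x : x \notin X -> (s1 * s2)%g x = s2 x.
Proof. by move=> xX; rewrite permM (out_perm s1X). Qed.

End DisjointProduct.

Lemma disjointXD (alpha X : {set 'I_n}) : [disjoint X & alpha :\: X].
Proof.
by rewrite -setI_eq0; apply/eqP/setP => x; rewrite !inE; case: (x \in X).
Qed.

(** The determinant on [alpha] with every cycle opened at its least element and
    no distinguished row.  It is what the expansion along the cycle of a given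
    index leaves on the complementary indices. *)
Definition canon_det alpha M : H :=
  \sum_(t : 'S_n | perm_on alpha t)
    (-1) ^+ (#|alpha| - #|porbit t @: alpha|) *
    \prod_(c < n | (c \in alpha) && [forall x in porbit t c, (c <= x)%N])
       cycle_prod M t c.

(** The paths that leave [l], run exactly through [X] and stop at [i].  For
    [l = i] in [X] they are the cycles on [X] opened at [i]. *)
Definition exitsum M l X i := \sum_m M l m * hampath M X m i.

Lemma homo_setC (s : 'S_n) X :
  {homo s : y / y \in X} -> {homo s : y / y \in ~: X}.
Proof.
move=> sX y; rewrite !inE; apply: contra => sy.
have oX : porbit s (s y) \subset X by apply: (porbit_sub_in (s := s)).
apply: (subsetP oX); rewrite porbit_sym; exact: (mem_porbit s 1).
Qed.

Lemma porbit_homo (s : 'S_n) i : {homo s : y / y \in porbit s i}.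
Proof.
move=> y /porbitP[e ->]; rewrite -permM -expgSr; exact: mem_porbit.
Qed.

Lemma restr_perm_in (s : 'S_n) X : {homo s : y / y \in X} ->
  {in X, restr_perm X s =1 s}.
Proof.
move=> sX x xX; apply: restr_permE => //.
apply/astabsP => y /=; rewrite /aperm; apply/idP/idP; last exact: sX.
by apply: contraTT => yX; have := @homo_setC s X sX y; rewrite !inE => ->.
Qed.

(** A permutation whose cycle through [i] has support [X] is a cyclic
    permutation of [X] times a permutation of the other elements of [alpha]. *)
Lemma sum_perm_split alpha X i (F : 'S_n -> H) : i \in X -> X \subset alpha ->
  \sum_(s : 'S_n | perm_on alpha s && (porbit s i == X)) F s =
  \sum_(s1 : 'S_n | is_cycle_on X i s1)
     \sum_(s2 : 'S_n | perm_on (alpha :\: X) s2) F (s1 * s2)%g.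
Proof.
move=> iX Xa; rewrite pair_big /=.
have dX := disjointXD alpha X.
rewrite (reindex_onto (fun p : 'S_n * 'S_n => p.1 * p.2)%g
  (fun s => (restr_perm X s, restr_perm (~: X) s))) /=; last first.
  move=> s /andP[sa /eqP oX]; have := @porbit_homo s i; rewrite oX => sX.
  apply/permP => x; have [xX|xX] := boolP (x \in X).
    rewrite permM (restr_perm_in sX xX) (out_perm (restr_perm_on _ _)) //.
    by rewrite !inE negbK sX.
  rewrite permM [restr_perm X s x](out_perm (restr_perm_on _ _)) //.
  by rewrite (restr_perm_in (homo_setC sX))// inE.
apply: eq_bigl => -[s1 s2] /=; apply/idP/idP; last first.
  case/andP=> /andP[s1X /eqP oX] s2a.
  have sl := mul_perm_onl dX s1X s2a; have sr := mul_perm_onr s2 s1X.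
  have sX : {homo (s1 * s2)%g : y / y \in X}.
    by move=> y yX; rewrite sl// (perm_closed _ s1X).
  rewrite (eq_porbit_in (perm_on_closed_homo s1X) sl iX) oX eqxx andbT.
  apply/andP; split.
    apply: perm_onM.
      exact: subset_trans Xa.
    by apply: subset_trans s2a _; exact: subsetDl.
  apply/eqP; congr pair; apply/permP => x.
    have [xX|xX] := boolP (x \in X); first by rewrite restr_perm_in// sl.
    by rewrite (out_perm (restr_perm_on _ _))// (out_perm s1X).
  have [xX|xX] := boolP (x \in X); last first.
    by rewrite (restr_perm_in (homo_setC sX)) ?inE ?sr.
  rewrite (out_perm (restr_perm_on _ _)) ?inE ?negbK//.
  by rewrite (out_perm s2a)// inE xX.
case/andP=> /andP[sa /eqP oX] /eqP[e1 e2].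
have sX : {homo (s1 * s2)%g : y / y \in X} by rewrite -oX; exact: porbit_homo.
have s1X : perm_on X s1 by rewrite -e1 restr_perm_on.
have s2X : perm_on (~: X) s2 by rewrite -e2 restr_perm_on.
have s1E : {in X, (s1 * s2)%g =1 s1}.
  by apply: mul_perm_onl s1X s2X; rewrite -setI_eq0 setICr.
apply/andP; split.
  rewrite /is_cycle_on s1X /=.
  by rewrite -(eq_porbit_in (perm_on_closed_homo s1X) s1E iX) oX.
rewrite /perm_on; apply/subsetP => x; rewrite !inE => s2x.
have xX : x \notin X.
  by apply: contraNN s2x => xX; rewrite (out_perm s2X)// inE negbK.
rewrite xX /=; apply: contraNT s2x => xa.
by rewrite -(mul_perm_onr s2 s1X xX) (out_perm sa).
Qed.

(** The cycles other than that of [i] are opened at their least elements and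
    multiplied by increasing least element, with or without the cycle of [i] in
    front of them; so the factor left by the cycle on [X] is [canon_det]. *)
Lemma rdet_on_expand alpha i M : i \in alpha ->
  rdet_on alpha i M =
  \sum_(X : {set 'I_n} | (i \in X) && (X \subset alpha))
     (-1) ^+ #|X|.-1 * (exitsum M i X i * canon_det (alpha :\: X) M).
Proof.
move=> ia; rewrite /rdet_on.
rewrite (partition_big (fun s : 'S_n => porbit s i)
  (fun X => (i \in X) && (X \subset alpha))) /=; last first.
  move=> s sa; rewrite porbit_id /=.
  by apply: (porbit_sub_in (s := s)) => //; exact: perm_on_closed_homo.
apply: eq_bigr => X /andP[iX Xa]; rewrite sum_perm_split//.
rewrite /exitsum -sum_cycle_prod// mulr_suml mulr_sumr.
apply: eq_bigr => s1 /andP[s1X /eqP oX] /=.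
rewrite /canon_det !mulr_sumr.
apply: eq_bigr => s2 s2a.
have dX := disjointXD alpha X.
have sl := mul_perm_onl dX s1X s2a; have sr := mul_perm_onr s2 s1X.
have hX := perm_on_closed_homo s1X; have hY := perm_on_closed_homo s2a.
have sr' : {in alpha :\: X, (s1 * s2)%g =1 s2}.
  by move=> x; rewrite inE => /andP[xX _]; exact: sr.
have oi : porbit (s1 * s2) i = X by rewrite (eq_porbit_in hX sl iX).
have im : [set porbit (s1 * s2) x | x in alpha] =
          X |: [set porbit s2 x | x in alpha :\: X].
  rewrite -[in LHS](setID alpha X) (setIidPr Xa) imsetU; congr (_ :|: _).
    apply/setP => B; rewrite inE; apply/imsetP/eqP => [[x xX ->]|->].
      by rewrite -oi; apply/eqP; rewrite eq_porbit_mem oi.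
    by exists i.
  by apply: eq_in_imset => x xY; rewrite (eq_porbit_in hY sr').
have XN : X \notin [set porbit s2 x | x in alpha :\: X].
  apply/negP => /imsetP[x xY XE]; move: (xY); rewrite inE.
  by rewrite XE porbit_id.
have cX : #|X| = #|X|.-1.+1 by rewrite (cardsD1 i) iX.
have ca : #|alpha| = (#|X|.-1.+1 + #|alpha :\: X|)%N.
  by rewrite -cX -(cardsID X alpha) (setIidPr Xa).
have cle := leq_imset_card (porbit s2) (mem (alpha :\: X)).
rewrite im cardsU1 XN ca /= addSn add1n subSS -addnBA; last exact: cle.
rewrite exprD -!mulrA; congr (_ * _).
rewrite [RHS]mulrA [cycle_prod M s1 i * _]commr_sign -mulrA.
congr (_ * _); congr (_ * _); first exact: (eq_cycle_prod_in hX sl).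
rewrite oi; apply: eq_big => c.
  rewrite andbA !inE [(c \in alpha) && _]andbC.
  have [//|cX'] := boolP (c \in X); have [ca'|//] := boolP (c \in alpha).
  by rewrite /= (eq_porbit_in hY sr')// inE cX'.
case/and3P=> ca' cX' _; apply: (eq_cycle_prod_in hY sr').
by rewrite inE cX'.
Qed.

Lemma canon_det0 M : canon_det set0 M = 1.
Proof.
rewrite /canon_det (big_pred1 1%g) => [|s]; last first.
  apply/idP/eqP => [s0|->]; last exact: perm_on1.
  by apply: (perm_on_id s0); rewrite cards0.
rewrite cards0 big_pred0 ?mulr1// => c; by rewrite inE.
Qed.

(** The factors of a product over ordinals come in increasing order, so the one
    of least index can be split off on the left without commutativity. *)
Lemma prod_ord_min (S : pzRingType) N (P : pred 'I_N) (F : 'I_N -> S)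
    (i : 'I_N) :
  P i -> (forall j : 'I_N, P j -> (i <= j)%N) ->
  \prod_(c < N | P c) F c = F i * \prod_(c < N | P c && (c != i)) F c.
Proof.
elim: N P F i => [|N IH] P F i Pi imin; first by case: i Pi imin.
rewrite [LHS]big_mkcond [\prod_(c < _ | _ && _) _]big_mkcond !big_ord_recl /=.
have [j ij|i0] := unliftP ord0 i.
  rewrite (_ : P ord0 = false) /=; last first.
    by apply/negbTE/negP => /imin; rewrite ij /=.
  rewrite !mul1r -!big_mkcond /=.
  rewrite (IH (fun c => P (lift ord0 c)) (fun c => F (lift ord0 c)) j); last 2 first.
  - by rewrite -ij.
  - by move=> k /imin; rewrite ij /= /bump /= !add1n ltnS.
  by rewrite ij; congr (_ * _); apply: eq_bigl => k; rewrite (inj_eq lift_inj).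
rewrite -i0 Pi eqxx /= mul1r; congr (_ * _); apply: eq_bigr => k _.
by rewrite i0 eq_sym neq_lift andbT.
Qed.

(** For the least index, putting its cycle first does not change the order. *)
Lemma canon_det_min alpha i M : i \in alpha ->
  (forall j, j \in alpha -> (i <= j)%N) -> canon_det alpha M = rdet_on alpha i M.
Proof.
move=> ia imin; apply: eq_bigr => s sa; congr (_ * _).
have orb c : c \in alpha -> porbit s c \subset alpha.
  by apply: (porbit_sub_in (s := s)) => //; exact: perm_on_closed_homo.
rewrite (@prod_ord_min _ _ _ _ i); first last.
- by move=> j /andP[ja _]; exact: imin.
- rewrite ia; apply/forallP => x; apply/implyP => xi.
  by apply: imin; apply: (subsetP (orb _ ia)).
congr (_ * _); apply: eq_bigl => c.
case ca : (c \in alpha) => //=; rewrite andbC.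
case: (boolP [forall x in _, _]) => [/forallP cmin|]; last by rewrite !andbF.
rewrite !andbT; congr negb; apply/eqP/idP => [->|ci]; first exact: porbit_id.
have := cmin i; rewrite porbit_sym ci /= => ic.
by apply/val_inj/eqP; rewrite eqn_leq ic imin.
Qed.

Lemma ord_set_min alpha : alpha != set0 ->
  exists2 i, i \in alpha & forall j, j \in alpha -> (i <= j)%N.
Proof.
by case/set0Pn => i0 i0a; case: (arg_minnP (fun j : 'I_n => j : nat) i0a) => i; exists i.
Qed.

Lemma eq_canon_det alpha M G : (forall a b, a \in alpha -> M a b = G a b) ->
  canon_det alpha M = canon_det alpha G.
Proof.
move=> MG; apply: eq_bigr => s sa; congr (_ * _); apply: eq_bigr => c /andP[ca _].
apply: eq_big_seq => x; rewrite -porbit_traject => xc; apply: MG.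
apply: (subsetP (porbit_sub_in _ _ ca)) xc => //; exact: perm_on_closed_homo.
Qed.

Lemma rdet_on_repl_row alpha i G (c : 'rV[H]_n) : i \in alpha ->
  rdet_on alpha i (repl_row G i c) =
  \sum_(X : {set 'I_n} | (i \in X) && (X \subset alpha))
    (-1) ^+ #|X|.-1 * ((\sum_j c 0 j * hampath G X j i) * canon_det (alpha :\: X) G).
Proof.
move=> ia; rewrite rdet_on_expand//; apply: eq_bigr => X /andP[iX _].
congr (_ * _); congr (_ * _).
  apply: eq_bigr => j _; rewrite mxE eqxx; congr (_ * _).
  by apply: eq_hampath => a b ai; rewrite mxE (negbTE ai).
apply: eq_canon_det => a b; rewrite inE mxE => /andP[aX _].
by rewrite (_ : a == i = false)//; apply: contraNF aX => /eqP ->.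
Qed.

End Hampath.

(** * Conjugation and real quaternions *)

Section QuaternionConj.
Variable R : realFieldType.
Implicit Types x y q : quat R.

Lemma addqE x y : x + y = Defs.addq x y :> quat R. Proof. by []. Qed.
Lemma mulqE x y : x * y = Defs.mulq x y :> quat R. Proof. by []. Qed.

Lemma conjqD x y : conjq (x + y) = conjq x + conjq y.
Proof. by rewrite !addqE /conjq /Defs.addq /=; congr Quat; rewrite opprD. Qed.
Lemma conjqM x y : conjq (x * y) = conjq y * conjq x.
Proof. by rewrite !mulqE /conjq /Defs.mulq /=; congr Quat; ring. Qed.
Lemma conjq0 : conjq (0 : quat R) = 0.
Proof. by rewrite /conjq /= !oppr0. Qed.
Lemma conjq1 : conjq (1 : quat R) = 1.
Proof. by rewrite /conjq /= !oppr0. Qed.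
Lemma conjqN x : conjq (- x) = - conjq x.
Proof. by []. Qed.
Lemma conjq_sum I (r : seq I) (P : pred I) (F : I -> quat R) :
  conjq (\sum_(i <- r | P i) F i) = \sum_(i <- r | P i) conjq (F i).
Proof. exact: (big_morph _ conjqD conjq0). Qed.
Lemma conjq_sign m : conjq ((-1) ^+ m : quat R) = (-1) ^+ m.
Proof.
by elim: m => [|m IH]; rewrite ?conjq1// exprS mulN1r conjqN IH.
Qed.

Lemma conjq_fixE q : conjq q = q -> q = qreal (qre q).
Proof.
case: q => a b c d; rewrite /conjq /qreal /= => -[hb hc hd].
by congr Quat; lra.
Qed.

Lemma qreal_comm (a : R) x : qreal a * x = x * qreal a.
Proof. by rewrite !mulqE /Defs.mulq /=; congr Quat; ring. Qed.

(** Quaternions fixed by conjugation are real, hence central. *)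
Lemma conjq_fix_comm q x : conjq q = q -> q * x = x * q.
Proof. by move=> /conjq_fixE ->; exact: qreal_comm. Qed.

Lemma qreMC x y : qre (x * y) = qre (y * x).
Proof. by rewrite !mulqE /=; ring. Qed.

Lemma qreD x y : qre (x + y) = qre x + qre y. Proof. by []. Qed.
Lemma qre_sum I (r : seq I) (P : pred I) (F : I -> quat R) :
  qre (\sum_(i <- r | P i) F i) = \sum_(i <- r | P i) qre (F i).
Proof. exact: (big_morph _ qreD). Qed.

End QuaternionConj.

(** * Determinants and cofactors of Hermitian matrices *)

(** Choosing a set and then a part of it amounts to choosing two disjoint
    sets; this exchanges the roles of the part and of its complement. *)
Lemma sum_disjoint_pairs (T : finType) (V : nmodType)
    (F : {set T} -> {set T} -> V) :
  \sum_(X : {set T}) \sum_(Y : {set T} | Y \subset X) F Y (X :\: Y) =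
  \sum_(Z : {set T}) \sum_(Y : {set T} | [disjoint Y & Z]) F Y Z.
Proof.
rewrite !pair_big_dep /=.
rewrite (reindex_onto (fun q : {set T} * {set T} => (q.2 :|: q.1, q.2))
                      (fun p => (p.1 :\: p.2, p.2))) /=; last first.
  move=> [X Y] /= YX.
  by rewrite setUC setDE setUIl setUC (setUidPr YX) setUC setUCr setIT.
apply: eq_big => [[Z Y]|[Z Y]] /=.
  rewrite subsetUl /= setDUl setDv set0U xpair_eqE eqxx andbT.
  apply/eqP/idP => [<-|YZ]; first by rewrite -setI_eq0 setDE setICA setICr setI0.
  by apply/setDidPl; rewrite disjoint_sym.
by case/andP=> _ /eqP[ZE]; rewrite ZE.
Qed.

Section HermitianPaths.
Variables (R : realFieldType) (n : nat).
Local Notation H := (quat R).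
Implicit Types (M G : 'M[H]_n) (X Y Z alpha : {set 'I_n}) (i j l m : 'I_n).

Lemma hampath_exit M X j i : j != i -> j \in X ->
  hampath M X j i = exitsum M j (X :\ j) i.
Proof. exact: hampathE. Qed.

Lemma exitsum_outr M l X i : i \notin X -> exitsum M l X i = 0.
Proof. by move=> iX; rewrite /exitsum big1// => m _; rewrite hampath_outr ?mulr0. Qed.

Lemma sum_subset_insert (V : nmodType) j X (F : {set 'I_n} -> V) : j \in X ->
  \sum_(Y : {set 'I_n} | (j \in Y) && (Y \subset X)) F Y =
  \sum_(Y : {set 'I_n} | Y \subset X :\ j) F (j |: Y).
Proof.
move=> jX; rewrite (reindex_onto (fun Y => j |: Y) (fun Y => Y :\ j)) /=; last first.
  by move=> Y /andP[jY _]; rewrite setD1K.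
apply: eq_bigl => Y; rewrite setU11 /= subUset sub1set jX /= subsetD1.
congr (_ && _); apply/eqP/idP => [<-|jY]; first by rewrite !inE eqxx.
by rewrite setU1K.
Qed.

(** A path on [X] visits [l] once; [Y] is the set of vertices up to that visit.
    The terms with [l \notin Y] or [i \in Y] are zero. *)
Lemma hampath_split M X j i l : l \in X -> l != i ->
  hampath M X j i =
  \sum_(Y : {set 'I_n} | Y \subset X) hampath M Y j l * exitsum M l (X :\: Y) i.
Proof.
have [N] := ubnP #|X|; elim: N X j => // N IH X j cX lX li.
have [jX|jX] := boolP (j \in X); last first.
  rewrite hampath_outl// big1// => Y YX; rewrite hampath_outl ?mul0r//.
  by apply: contra jX; exact: (subsetP YX).
have [->{jX}|jl] := eqVneq j l.
  rewrite hampath_exit// (bigD1 [set l]) ?sub1set//= big1 => [|Y /andP[_ Yl]].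
    by rewrite addr0 hampath_diag eqxx mul1r.
  by rewrite hampath_diag (negbTE Yl) mul0r.
have [ji|ji] := eqVneq j i.
  rewrite ji hampath_diag (_ : _ == _ = false); last first.
    by apply/eqP => XE; move: lX; rewrite XE inE (negbTE li).
  rewrite big1// => Y YX; have [iY|iY] := boolP (i \in Y).
    by rewrite exitsum_outr ?mulr0// inE iY.
  by rewrite hampath_outl// mul0r.
rewrite (bigID (fun Y => j \in Y)) /= [X in _ + X]big1 ?addr0; last first.
  by move=> Y /andP[_ jY]; rewrite hampath_outl// mul0r.
under eq_bigl do rewrite andbC.
rewrite sum_subset_insert// hampathE//.
have cXj : (#|X :\ j| < N)%N by move: cX; rewrite (cardsD1 j X) jX.
have lXj : l \in X :\ j by rewrite !inE eq_sym jl.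
under eq_bigr => m _ do rewrite (IH _ _ cXj lXj li) mulr_sumr.
rewrite exchange_big /=; apply: eq_bigr => Y YX.
have jY : j \notin Y by move: YX; rewrite subsetD1 => /andP[].
rewrite [in RHS]hampathE// ?setU11// setU1K// mulr_suml.
by apply: eq_bigr => m _; rewrite setDDl mulrA.
Qed.

Lemma exitsum_split M a X i l : l \in X -> l != i ->
  exitsum M a X i =
  \sum_(Y : {set 'I_n} | Y \subset X) exitsum M a Y l * exitsum M l (X :\: Y) i.
Proof.
move=> lX li; rewrite {1}/exitsum.
under eq_bigr => m _ do rewrite (hampath_split _ _ lX li) mulr_sumr.
rewrite exchange_big /=; apply: eq_bigr => Y _; rewrite mulr_suml.
by apply: eq_bigr => m _; rewrite mulrA.
Qed.

(** The defining recursion peels off the first edge of a path; peeling off the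
    last one instead is what reversing paths requires. *)
Lemma hampath_last M X j i : j != i -> i \in X ->
  hampath M X j i = \sum_m hampath M (X :\ i) j m * M m i.
Proof.
have [N] := ubnP #|X|; elim: N X j => // N IH X j cX ji iX.
have [jX|jX] := boolP (j \in X); last first.
  rewrite hampath_outl// big1// => m _.
  by rewrite hampath_outl ?mul0r// !inE negb_and jX orbT.
have cXj : (#|X :\ j| < N)%N by move: cX; rewrite (cardsD1 j X) jX.
have iXj : i \in X :\ j by rewrite !inE eq_sym ji.
have jXi : j \in X :\ i by rewrite !inE ji.
rewrite hampathE// (bigD1 i)//= [RHS](bigD1 j)//= !hampath_diag; congr (_ + _).
  rewrite (_ : (X :\ j == [set i]) = (X :\ i == [set j])).
    by case: (_ == _); rewrite ?mulr1 ?mul1r ?mulr0 ?mul0r.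
  have card1 a b : a \in X -> b \in X :\ a -> (X :\ a == [set b]) = (#|X| == 2).
    move=> aX bXa; rewrite eq_sym eqEcard sub1set bXa cards1 (cardsD1 a X) aX.
    have : (0 < #|X :\ a|)%N by apply/card_gt0P; exists b.
    by case: #|_| => [|[|]].
  by rewrite !card1.
under eq_bigr => m mi do rewrite IH// mulr_sumr.
rewrite exchange_big /= (bigD1 j)//= big1 ?add0r; last first.
  move=> m _; rewrite hampath_outr ?mul0r ?mulr0// !inE eqxx andbF//.
apply: eq_bigr => m mj; rewrite hampathE//; last by rewrite eq_sym.
rewrite mulr_suml [RHS](bigD1 i)//= hampath_outl ?mulr0 ?mul0r ?add0r; last first.
  by rewrite !inE eqxx andbF.
by apply: eq_bigr => l _; rewrite mulrA !setDDl setUC.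
Qed.

Variable G : 'M[H]_n.
Hypothesis GH : hermitianq G.

Lemma herm_conj i j : conjq (G i j) = G j i.
Proof. by rewrite -[in RHS]GH !mxE. Qed.

(** For a Hermitian matrix the product along the reversed path is the conjugate
    of the product along the path. *)
Lemma hampath_conj X j i : conjq (hampath G X j i) = hampath G X i j.
Proof.
have [N] := ubnP #|X|; elim: N X j => // N IH X j cX.
have [->|ji] := eqVneq j i.
  by rewrite hampath_diag; case: (_ == _); rewrite ?conjq1 ?conjq0.
have [jX|jX] := boolP (j \in X); last by rewrite hampath_outl// hampath_outr// conjq0.
rewrite hampathE// hampath_last//; last by rewrite eq_sym.
rewrite conjq_sum; apply: eq_bigr => m _; rewrite conjqM herm_conj IH//.
by move: cX; rewrite (cardsD1 j X) jX.
Qed.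

(** The sum runs over both orientations of each cycle, and these contribute
    conjugate products. *)
Lemma cycle_real X i : conjq (exitsum G i X i) = exitsum G i X i.
Proof.
have [iX|iX] := boolP (i \in X); last by rewrite exitsum_outr// conjq0.
rewrite /exitsum conjq_sum (bigD1 i)//= [RHS](bigD1 i)//=.
rewrite conjqM hampath_conj herm_conj hampath_diag; congr (_ + _).
  by case: (_ == _); rewrite ?mulr1 ?mul1r ?mulr0 ?mul0r.
under eq_bigr => m mi.
  rewrite conjqM hampath_conj herm_conj hampathE 1?eq_sym// mulr_suml.
  over.
under [RHS]eq_bigr => m mi do rewrite hampath_last// mulr_sumr.
rewrite exchange_big /= (bigD1 i)//= big1 ?add0r; last first.
  by move=> m _; rewrite hampath_outl ?mulr0 ?mul0r// !inE eqxx.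
apply: eq_bigr => m mi; rewrite [RHS](bigD1 i)//= hampath_outr ?inE ?eqxx//.
rewrite mul0r mulr0 add0r; by apply: eq_bigr => j _; rewrite mulrA.
Qed.

(** Cut at [l], a cycle opened at [i] is a path product [x * y]; opened at [l]
    it is [y * x], which has the same real part, and both sums are real. *)
Lemma cycle_indep X i l : i \in X -> l \in X ->
  exitsum G i X i = exitsum G l X l.
Proof.
move=> iX lX; have [->//|li] := eqVneq l i.
rewrite (conjq_fixE (cycle_real X i)) (conjq_fixE (cycle_real X l)).
congr qreal; rewrite (exitsum_split _ _ lX li).
rewrite (exitsum_split (l := i) _ l iX) 1?eq_sym// !qre_sum.
rewrite (reindex_onto (fun Y => X :\: Y) (fun Y => X :\: Y)) /=; last first.
  by move=> Y YX; rewrite setDDr setDv set0U (setIidPr YX).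
apply: eq_big => [Y|Y].
  rewrite subsetDl /= setDDr setDv set0U; apply/eqP/idP => [<-|/setIidPr//].
  exact: subsetIl.
by case/andP=> _ /eqP ->; ring.
Qed.


(** Signs are central; this collects those of two nested expansions. *)
Lemma sign_mulACA (S : pzRingType) p q (a b d : S) :
  (-1) ^+ p * (a * ((-1) ^+ q * (b * d))) = (-1) ^+ (p + q) * (a * b * d).
Proof. by rewrite exprD -!mulrA; congr (_ * _); rewrite !mulrA commr_sign. Qed.

(** Induction on the size of [alpha].  Expand along [i] and along the least
    element [i0].  The cycles through both contribute equally by [cycle_indep].
    For a cycle on [X] through only one of them, the determinant of the
    complement is expanded along the other: this gives a double sum over
    disjoint cycles through [i] and [i0] in which the two play the same role,
    because cycle sums are central. *)
Lemma canon_det_rdet alpha i : i \in alpha ->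
  canon_det alpha G = rdet_on alpha i G /\ 
  conjq (canon_det alpha G) = canon_det alpha G.
Proof.
have [N] := ubnP #|alpha|; elim: N alpha i => // N IH alpha i ca ia.
have [|i0 i0a i0min] := @ord_set_min _ alpha; first by apply/set0Pn; exists i.
have Dreal (beta : {set 'I_n}) : (#|beta| < N)%N ->
    conjq (canon_det beta G) = canon_det beta G.
  move=> cb; have [->|/set0Pn[j jb]] := eqVneq beta set0.
    by rewrite canon_det0 conjq1.
  by have [] := IH _ _ cb jb.
have cD X : i0 \in X -> X \subset alpha -> (#|alpha :\: X| < N)%N.
  move=> i0X Xa; rewrite -ltnS; apply: leq_ltn_trans ca.
  apply: proper_card; rewrite properE subsetDl.
  by apply/subsetPn; exists i0; rewrite ?inE ?i0X.
have D0 := canon_det_min G i0a i0min.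
split; last first.
  rewrite D0 rdet_on_expand// conjq_sum; apply: eq_bigr => X /andP[i0X Xa].
  rewrite !conjqM conjq_sign cycle_real Dreal ?cD// -mulrA -commr_sign.
  by rewrite mulrA (conjq_fix_comm _ (Dreal _ (cD _ i0X Xa))).
have [->//|ii0] := eqVneq i i0.
rewrite D0 !rdet_on_expand//.
(* Separate the cycles through both [i] and [i0] from the others. *)
rewrite (bigID (fun X => i \in X)) [RHS](bigID (fun X => i0 \in X)) /=.
congr (_ + _).
  apply: eq_big => X; first by rewrite andbAC [RHS]andbAC [(i0 \in X) && _]andbC.
  by case/andP=> /andP[i0X _] iX; rewrite (cycle_indep i0X iX).
transitivity (\sum_(X : {set 'I_n} | ((i0 \in X) && (X \subset alpha)) && (i \notin X))
   \sum_(Y : {set 'I_n} | (i \in Y) && (Y \subset alpha :\: X))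
     (-1) ^+ (#|X|.-1 + #|Y|.-1) *
     (exitsum G i0 X i0 * exitsum G i Y i * canon_det (alpha :\: (X :|: Y)) G)).
  apply: eq_bigr => X /andP[/andP[i0X Xa] iX].
  have iaX : i \in alpha :\: X by rewrite inE iX.
  have [-> _] := IH _ _ (cD _ i0X Xa) iaX.
  rewrite rdet_on_expand// !mulr_sumr; apply: eq_bigr => Y _.
  by rewrite sign_mulACA setDDl.
rewrite (exchange_big_dep
  (fun Y : {set 'I_n} => ((i \in Y) && (Y \subset alpha)) && (i0 \notin Y))) /=; last first.
  move=> X Y /andP[/andP[i0X Xa] iX] /andP[iY].
  rewrite subsetD => /andP[-> dYX]; rewrite iY /=.
  by apply: contraTN dYX => i0Y; apply/pred0Pn; exists i0; rewrite /= i0X i0Y.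
apply: eq_bigr => Y /andP[/andP[iY Ya] i0Y].
have cDY : (#|alpha :\: Y| < N)%N.
  rewrite -ltnS; apply: leq_ltn_trans ca.
  apply: proper_card; rewrite properE subsetDl.
  by apply/subsetPn; exists i; rewrite ?inE ?iY.
have i0aY : i0 \in alpha :\: Y by rewrite inE i0Y.
have [-> _] := IH _ _ cDY i0aY.
rewrite rdet_on_expand// !mulr_sumr; apply: eq_big => X.
  rewrite !subsetD iY Ya /= disjoint_sym.
  case: (boolP [disjoint X & Y]) => [dXY|]; last by rewrite !andbF.
  by rewrite (disjointFl dXY iY) !andbT.
move=> _; rewrite sign_mulACA setDDl [Y :|: X]setUC addnC.
by rewrite (conjq_fix_comm _ (cycle_real Y i)).
Qed.

Lemma canon_det_real alpha : conjq (canon_det alpha G) = canon_det alpha G.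
Proof.
have [->|/set0Pn[i ia]] := eqVneq alpha set0; first by rewrite canon_det0 conjq1.
by have [] := canon_det_rdet ia.
Qed.

Lemma pminor_canon alpha : pminor alpha G = canon_det alpha G.
Proof.
rewrite /pminor; case: pickP => [i ia|a0]; first by have [] := canon_det_rdet ia.
by rewrite (_ : alpha = set0) ?canon_det0//; apply/setP => x; rewrite a0 inE.
Qed.

(** The entry [(j, i)] of the adjugate of the principal submatrix of [G] on
    [alpha]: a path from [j] to [i], closed up by an edge from [i] to [j], is
    the distinguished cycle of the row determinant along [i]. *)
Definition path_cofactor alpha j i : H :=
  \sum_(X : {set 'I_n} | X \subset alpha)
    (-1) ^+ #|X|.-1 * (hampath G X j i * canon_det (alpha :\: X) G).

Lemma rdet_on_repl_cofactor alpha i (c : 'rV[H]_n) : i \in alpha ->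
  rdet_on alpha i (repl_row G i c) = \sum_j c 0 j * path_cofactor alpha j i.
Proof.
move=> ia; rewrite rdet_on_repl_row//.
under [RHS]eq_bigr => j _ do rewrite mulr_sumr.
rewrite exchange_big /= [RHS](bigID (fun X : {set 'I_n} => i \in X)) /=.
rewrite [X in _ = _ + X]big1 ?addr0; last first.
  move=> X /andP[_ iX]; rewrite big1// => j _.
  by rewrite hampath_outr// mul0r !mulr0.
apply: eq_big => [X|X _]; first by rewrite andbC.
rewrite mulr_suml mulr_sumr; apply: eq_bigr => j _.
by rewrite !mulrA commr_sign.
Qed.

Lemma canon_det_cofactor alpha i : i \in alpha ->
  canon_det alpha G = \sum_j G i j * path_cofactor alpha j i.
Proof.
move=> ia; have [-> _] := canon_det_rdet ia.
have := rdet_on_repl_cofactor (row i G) ia.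
rewrite (_ : repl_row G i (row i G) = G).
  by move=> ->; apply: eq_bigr => j _; rewrite mxE.
by apply/matrixP => a b; rewrite !mxE; case: eqP => [->|].
Qed.

Lemma path_cofactor_diag alpha i : i \in alpha ->
  path_cofactor alpha i i = canon_det (alpha :\ i) G.
Proof.
move=> ia; rewrite /path_cofactor (bigD1 [set i]) ?sub1set//= big1 => [|X /andP[_ Xi]].
  by rewrite hampath_diag eqxx cards1 !mul1r addr0.
by rewrite hampath_diag (negbTE Xi) mul0r mulr0.
Qed.

Lemma row_cofactorE alpha l i :
  \sum_j G l j * path_cofactor alpha j i =
  \sum_(X : {set 'I_n} | X \subset alpha)
    (-1) ^+ #|X|.-1 * (exitsum G l X i * canon_det (alpha :\: X) G).
Proof.
under eq_bigr => j _ do rewrite mulr_sumr.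
rewrite exchange_big; apply: eq_bigr => X _.
rewrite mulr_suml mulr_sumr; apply: eq_bigr => j _.
by rewrite !mulrA commr_sign.
Qed.

(** A path in [l |: alpha] from [l] to [i <> l] is an edge out of [l] followed by
    a path in [alpha]; the additional vertex changes the sign. *)
Lemma path_cofactor_rec alpha l i : i \in alpha -> l \notin alpha -> l != i ->
  path_cofactor (l |: alpha) l i = - \sum_j G l j * path_cofactor alpha j i.
Proof.
move=> ia la li; rewrite row_cofactorE /path_cofactor.
rewrite (bigID (fun X => l \in X)) /= [X in _ + X]big1 ?addr0; last first.
  by move=> X /andP[_ lX]; rewrite hampath_outl// mul0r mulr0.
under eq_bigl do rewrite andbC.
rewrite sum_subset_insert ?setU11// setU1K// -sumrN.
apply: eq_bigr => X Xa; have lX : l \notin X by apply: contra la; exact: (subsetP Xa).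
rewrite hampath_exit ?setU11// setU1K//.
have -> : (l |: alpha) :\: (l |: X) = alpha :\: X.
  apply/setP => x; rewrite !inE negb_or; case: eqP => //= ->.
  by rewrite (negbTE la) andbF.
have [iX|iX] := boolP (i \in X); last by rewrite exitsum_outr// mul0r !mulr0 oppr0.
by rewrite cardsU1 lX (cardsD1 i X) iX /= add1n exprS mulN1r mulNr.
Qed.

(** The analogue of a determinant with two equal rows.  A path that leaves [l]
    and ends at [i] may return to [l] on its way.  If it does, it is a cycle
    through [l] on some [Y] followed by a path on some [Z] disjoint from [Y].
    Summing the cycles over [Y] with the rest of the determinant restores
    [canon_det (alpha :\: Z)], expanded along [l], so these terms cancel those
    of the paths on [Z] that avoid [l], which have the opposite sign. *)
Lemma row_cofactor0 alpha l i : l \in alpha -> l != i ->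
  \sum_j G l j * path_cofactor alpha j i = 0.
Proof.
move=> la li; rewrite row_cofactorE.
rewrite (bigID (fun X => l \in X)) /=.
(* The contribution of a cycle on [Y] through [l] followed by a path on [Z]. *)
pose F Y Z : H := if [&& l \in Y, Y \subset alpha & Z \subset alpha] then
   (-1) ^+ (#|Z| + #|Y|.-1) * (exitsum G l Y l * exitsum G l Z i *
     canon_det (alpha :\: Z :\: Y) G) else 0.
transitivity ((\sum_(Z : {set 'I_n}) \sum_(Y : {set 'I_n} | [disjoint Y & Z]) F Y Z)
 - \sum_(Z : {set 'I_n} | (Z \subset alpha) && (l \notin Z))
    (-1) ^+ #|Z| * (exitsum G l Z i * canon_det (alpha :\: Z) G)).
  congr (_ + _); last first.
    rewrite -sumrN; apply: eq_bigr => X _.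
    have [iX|iX] := boolP (i \in X); last by rewrite exitsum_outr// mul0r !mulr0 oppr0.
    by rewrite (cardsD1 i X) iX /= add1n exprS mulN1r mulNr opprK.
  rewrite -sum_disjoint_pairs big_mkcond /=; apply: eq_bigr => X _.
  case: ifP => [/andP[Xa lX]|]; last first.
    move/negP => nX; rewrite big1// => Y YX.
    rewrite /F; case: ifP => // /and3P[lY Ya XYa].
    case: nX; rewrite (subsetP YX)// andbT.
    by rewrite -(setID X Y) subUset XYa andbT subIset// Ya orbT.
  rewrite (exitsum_split _ _ lX li) mulr_suml mulr_sumr; apply: eq_bigr => Y YX.
  rewrite /F (subset_trans YX Xa) (subset_trans (subsetDl _ _) Xa) /= andbT.
  have [lY|lY] := boolP (l \in Y); last by rewrite exitsum_outr// !mul0r mulr0.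
  have -> : alpha :\: (X :\: Y) :\: Y = alpha :\: X.
    by rewrite setDDl setUC -[in RHS](setID X Y) (setIidPr YX).
  rewrite (_ : #|X|.-1 = (#|X :\: Y| + #|Y|.-1)%N)//.
  have Y0 : (0 < #|Y|)%N by apply/card_gt0P; exists l.
  by rewrite cardsD (setIidPr YX); have := subset_leq_card YX; lia.
apply/eqP; rewrite subr_eq0; apply/eqP.
rewrite [RHS]big_mkcond /=; apply: eq_bigr => Z _.
case: ifP => [/andP[Za lZ]|nZ]; last first.
  rewrite big1// => Y dYZ; rewrite /F; case: ifP => // /and3P[lY Ya Za].
  by move: nZ; rewrite Za (disjointFr dYZ lY).
have laZ : l \in alpha :\: Z by rewrite inE lZ.
have [-> _] := canon_det_rdet laZ.
rewrite rdet_on_expand// !mulr_sumr (big_mkcond (fun Y => [disjoint Y & Z])).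
rewrite [RHS]big_mkcond /=; apply: eq_bigr => Y _.
rewrite /F subsetD Za andbT.
case: (boolP [disjoint Y & Z]) => dYZ; last by rewrite !andbF.
rewrite andbT; case: ifP => // _; rewrite sign_mulACA.
by rewrite (conjq_fix_comm _ (cycle_real Y l)).
Qed.

End HermitianPaths.

(** * Rank and trace of quaternion matrices *)

From mathcomp Require Import boolp.

Section MatrixFacts.
Variable R : realFieldType.
Local Notation H := (quat R).

Lemma adjqM m n p (A : 'M[H]_(m, n)) (B : 'M[H]_(n, p)) :
  adjq (A *m B) = adjq B *m adjq A.
Proof.
apply/matrixP => i j; rewrite !mxE conjq_sum; apply: eq_bigr => k _.
by rewrite !mxE conjqM.
Qed.

Lemma adjqK m n (A : 'M[H]_(m, n)) : adjq (adjq A) = A.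
Proof.
by apply/matrixP => i j; rewrite !mxE; case: (A i j) => *; rewrite /conjq /= !opprK.
Qed.

Lemma adjq_mul_eq0 m n (M : 'M[H]_(m, n)) : adjq M *m M = 0 -> M = 0.
Proof.
move=> /matrixP M0; apply/matrixP => k i; rewrite mxE.
have sq_ge0 (x : H) : 0 <= sqnormq x by rewrite /sqnormq !addr_ge0 ?sqr_ge0.
have : \sum_k sqnormq (M k i) = 0.
  have := congr1 (@qre R) (M0 i i); rewrite !mxE qre_sum => E.
  rewrite -[RHS]E; apply: eq_bigr => l _; by rewrite !mxE /sqnormq mulqE /=; ring.
move/eqP; rewrite psumr_eq0// => /allP/(_ k); rewrite mem_index_enum => /(_ isT).
by rewrite sqnormq_eq0 => /eqP.
Qed.

(** The real part is what makes the trace cyclic over the quaternions. *)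
Definition retrace n (M : 'M[H]_n) : R := \sum_i qre (M i i).

Lemma retraceC m n (A : 'M[H]_(m, n)) (B : 'M[H]_(n, m)) :
  retrace (A *m B) = retrace (B *m A).
Proof.
rewrite /retrace; under eq_bigr => i _ do rewrite mxE qre_sum.
rewrite exchange_big /=; apply: eq_bigr => j _; rewrite mxE qre_sum.
by apply: eq_bigr => i _; exact: qreMC.
Qed.

Lemma mul_mx_real m n (a : H) (M : 'M[H]_(m, n)) : conjq a = a ->
  M *m a%:M = a *: M.
Proof.
move=> ar; apply/matrixP => i j; rewrite !mxE (bigD1 j)//= big1 => [|k kj].
  by rewrite !mxE eqxx mulr1n addr0 (conjq_fix_comm _ ar).
by rewrite !mxE (negbTE kj) mulr0n mulr0.
Qed.

Lemma scalemx_realAr m n p (a : H) (M : 'M[H]_(m, n)) (N : 'M[H]_(n, p)) :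
  conjq a = a -> M *m (a *: N) = a *: (M *m N).
Proof. by move=> ar; rewrite -mul_scalar_mx mulmxA mul_mx_real// scalemxAl. Qed.

Lemma conjq_fixV (q : H) : conjq q = q -> conjq q^-1 = q^-1.
Proof.
move=> qr; have [->|q0] := eqVneq q 0; first by rewrite invr0 conjq0.
apply: (mulIr (x := q)) => //.
by rewrite -[X in _ * X = _]qr -conjqM mulrV// mulVr// conjq1.
Qed.

(** A largest set [S] of independent columns spans all columns; the matrix [F]
    expresses every column in terms of those of [S]. *)
Lemma rank_basis m n (M : 'M[H]_(m, n)) : exists2 S : {set 'I_n},
  right_free_cols M S /\ #|S| = rankq M &
  exists2 F : 'M[H]_n, M *m F = M & forall l j, l \notin S -> F l j = 0.
Proof.
have free0 : right_free_cols M set0.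
  by move=> c c0 _; apply/colP => j; rewrite mxE c0 ?inE.
have [|S /asboolP Sfree rE] := @eq_bigmax_cond {set 'I_n}
  [pred S : {set 'I_n} | `[< right_free_cols M S >]] (fun S => #|S|).
  by apply/card_gt0P; exists set0; apply/asboolP.
have rankE : rankq M = #|S| by rewrite /rankq -rE.
exists S; first by [].
suff /fin_all_exists[f fP] : forall j, exists c : 'cV[H]_n,
    (forall l, l \notin S -> c l 0 = 0) /\ M *m c = col j M.
  exists (\matrix_(l, j) f j l 0).
    apply/matrixP => i j; have [_ /colP/(_ i)] := fP j; rewrite !mxE => <-.
    by apply: eq_bigr => l _; rewrite mxE.
  by move=> l j lS; rewrite mxE; have [-> //] := fP j.
move=> j; have [jS|jS] := boolP (j \in S).
  exists (delta_mx j 0); split; last by rewrite -colE.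
  by move=> l lS; rewrite mxE (_ : l == j = false)//; apply: contraNF lS => /eqP ->.
have : ~ right_free_cols M (j |: S).
  move=> /asboolP jSfree.
  have := @leq_bigmax_cond {set 'I_n} (fun S => `[< right_free_cols M S >])
    (fun S => #|S|) _ jSfree.
  by rewrite -/(rankq M) rankE cardsU1 jS add1n ltnn.
move/existsNP=> [c /not_implyP[cS /not_implyP[Mc c0]]].
have cj : c j 0 != 0.
  apply: contra_notN c0 => /eqP cj; apply: Sfree => // l lS.
  by have [->//|lj] := eqVneq l j; apply: cS; rewrite !inE negb_or lj.
exists (\col_l if l == j then 0 else - (c l 0 * (c j 0)^-1)); split.
  move=> l lS; rewrite mxE; case: eqP => [//|/eqP lj].
  by rewrite cS ?mul0r ?oppr0// !inE negb_or lj.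
apply/colP => i; rewrite !mxE (bigD1 j)//= !mxE eqxx mulr0 add0r.
have /colP/(_ i) := Mc; rewrite !mxE (bigD1 j)//= => /eqP.
rewrite addr_eq0 => /eqP E.
transitivity (M i j * c j 0 * (c j 0)^-1); last first.
  by rewrite -mulrA divrr ?mulr1.
rewrite E mulNr mulr_suml -sumrN; apply: eq_bigr => l lj.
by rewrite mxE (negbTE lj) mulrN mulrA.
Qed.

(** Factor [M] through its independent columns as [M F].  By cyclicity the real
    trace is that of [F Z M].  This matrix fixes the basis vector [e_j] of each
    independent column, because [M F Z M e_j = M e_j], and its rows of other
    indices are zero. *)
Lemma retrace_projection m n (M : 'M[H]_(m, n)) (Z : 'M[H]_(n, m)) :
  M *m Z *m M = M -> retrace (M *m Z) = (rankq M)%:R.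
Proof.
move=> EM; have [S [Sfree <-] [F MF FS]] := rank_basis M.
have FZMS l j : j \in S -> (F *m (Z *m M)) l j = (l == j)%:R.
  move=> jS; pose v := col j (F *m (Z *m M)) - delta_mx j 0.
  have /colP/(_ l) : v = 0; last first.
    by rewrite !mxE eqxx andbT => /eqP; rewrite subr_eq0 => /eqP.
  apply: Sfree => [i iS|].
    rewrite !mxE eqxx andbT big1 => [|k _]; last by rewrite FS ?mul0r.
    by rewrite (_ : i == j = false) ?subr0//; apply: contraNF iS => /eqP ->.
  rewrite mulmxBr -colE [col j (F *m _)]colE !mulmxA MF EM -colE; exact: subrr.
rewrite -[in LHS]MF -mulmxA retraceC -mulmxA /retrace.
rewrite (bigID (fun j => j \in S)) /= [X in _ + X]big1 ?addr0; last first.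
  by move=> j jS; rewrite mxE big1// => k _; rewrite FS ?mul0r.
rewrite (eq_bigr (fun=> 1)); first by rewrite sumr_const.
by move=> j jS; rewrite FZMS// eqxx.
Qed.

End MatrixFacts.

(** * Characteristic coefficients of a Hermitian matrix *)

Section HermitianAdjugate.
Variables (R : realFieldType) (n : nat).
Local Notation H := (quat R).
Variable G : 'M[H]_n.
Hypothesis GH : hermitianq G.
Implicit Types (alpha beta : {set 'I_n}) (i j l : 'I_n).

(** The coefficients of the characteristic polynomial, up to sign. *)
Definition minorsum p : H := \sum_(alpha : {set 'I_n} | #|alpha| == p) canon_det alpha G.

(** The sum of the adjugates of the principal submatrices of order [p], each
    extended by zero. *)
Definition adjmx p : 'M[H]_n := \matrix_(j, i)
  \sum_(alpha : {set 'I_n} | (#|alpha| == p) && (i \in alpha)) path_cofactor G alpha j i.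

Lemma minorsum_real p : conjq (minorsum p) = minorsum p.
Proof. by rewrite /minorsum conjq_sum; apply: eq_bigr => a _; rewrite canon_det_real. Qed.

Lemma sum_card_insert (V : nmodType) p l (P : pred {set 'I_n}) (F : {set 'I_n} -> V) :
  \sum_(beta : {set 'I_n} | (#|beta| == p.+1) && (l \in beta) && P beta) F beta =
  \sum_(alpha : {set 'I_n} | (#|alpha| == p) && (l \notin alpha) && P (l |: alpha))
     F (l |: alpha).
Proof.
rewrite (reindex_onto (fun alpha => l |: alpha) (fun beta => beta :\ l)) /=; last first.
  by move=> beta /andP[/andP[_ lb] _]; rewrite setD1K.
apply: eq_bigl => alpha; rewrite setU11 andbT andbAC.
have -> : ((l |: alpha) :\ l == alpha) = (l \notin alpha).
  apply/eqP/idP => [<-|la]; first by rewrite !inE eqxx.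
  by rewrite setU1K.
case la : (l \notin alpha); last by rewrite !andbF.
by rewrite !andbT cardsU1 la.
Qed.

Lemma adjmx_diag p i :
  adjmx p.+1 i i =
  \sum_(alpha : {set 'I_n} | (#|alpha| == p) && (i \notin alpha)) canon_det alpha G.
Proof.
rewrite mxE (eq_bigl (fun beta => (#|beta| == p.+1) && (i \in beta) && true)); last first.
  by move=> beta; rewrite andbT.
rewrite (sum_card_insert p i predT) /=; apply: eq_big => [alpha|alpha]; first by rewrite andbT.
by move=> /andP[/andP[_ ia] _]; rewrite path_cofactor_diag ?setU11// setU1K.
Qed.

(** Off the diagonal, in row [l] and column [i], the index sets containing [l]
    give two equal rows and vanish, while for the others [path_cofactor_rec] identifies
    the terms of [G *m adjmx p] with those of [adjmx p.+1].  On the diagonal the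
    index sets containing [i] come from [G *m adjmx p] and the others from
    [adjmx p.+1]. *)
Lemma adjmx_rec p : adjmx p.+1 = (minorsum p)%:M - G *m adjmx p.
Proof.
apply/eqP; rewrite eq_sym subr_eq; apply/eqP/matrixP => l i.
rewrite [in RHS]mxE [(G *m _) l i]mxE [LHS]mxE.
have -> : \sum_j G l j * adjmx p j i =
    \sum_(alpha : {set 'I_n} | (#|alpha| == p) && (i \in alpha))
       \sum_j G l j * path_cofactor G alpha j i.
  by rewrite exchange_big; apply: eq_bigr => j _; rewrite mxE mulr_sumr.
have [->|li] := eqVneq l i.
  rewrite mulr1n adjmx_diag addrC /minorsum (bigID (fun alpha => i \in alpha)) /=.
  congr (_ + _); apply: eq_bigr => alpha /andP[_ ia].
  by rewrite (canon_det_cofactor GH ia).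
rewrite mulr0n mxE (bigID (fun beta => l \in beta)) /= [X in _ + X + _]big1; last first.
  move=> beta /andP[_ lb]; rewrite /path_cofactor big1// => X Xb.
  by rewrite hampath_outl ?mul0r ?mulr0//; apply: contra lb; exact: (subsetP Xb).
rewrite (eq_bigl (fun beta => (#|beta| == p.+1) && (l \in beta) && (i \in beta))); last first.
  by move=> beta; rewrite andbAC.
rewrite (sum_card_insert p l (fun beta => i \in beta)) addr0.
rewrite [X in _ + X](bigID (fun beta => l \in beta)) /= [X in _ + (X + _)]big1 ?add0r; last first.
  by move=> alpha /andP[/andP[_ ia] la]; rewrite row_cofactor0.
under [X in _ + X]eq_bigl do rewrite andbAC.
under eq_bigl do rewrite in_setU1 [i == l]eq_sym (negbTE li) /=.
rewrite -big_split big1// => alpha /andP[/andP[_ la] ia] /=.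
by rewrite path_cofactor_rec// addNr.
Qed.

Lemma adjmx0 : adjmx 0 = 0.
Proof.
apply/matrixP => j i; rewrite !mxE big_pred0// => alpha.
by apply/negbTE/negP => /andP[/eqP/cards0_eq ->]; rewrite inE.
Qed.

Lemma adjmx_big p : (n < p)%N -> adjmx p = 0.
Proof.
move=> np; apply/matrixP => j i; rewrite !mxE big_pred0// => alpha.
apply/negbTE/negP => /andP[/eqP ca _]; have := max_card (mem alpha).
by rewrite ca card_ord leqNgt np.
Qed.

Lemma adjmx_comm p : G *m adjmx p = adjmx p *m G.
Proof.
elim: p => [|p IH]; first by rewrite adjmx0 mulmx0 mul0mx.
rewrite adjmx_rec mulmxBr mulmxBl mul_mx_real ?minorsum_real// mul_scalar_mx.
by rewrite {1}IH mulmxA.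
Qed.

(** Each minor of order [p] occurs on the diagonal once for every index outside
    its index set. *)
Lemma retrace_adjmx p : (p <= n)%N ->
  retrace (adjmx p.+1) = (n - p)%:R * qre (minorsum p).
Proof.
move=> pn; rewrite /retrace /minorsum qre_sum.
under eq_bigr => i _ do rewrite adjmx_diag qre_sum.
under eq_bigr => i _ do rewrite big_mkcondr.
rewrite exchange_big mulr_sumr; apply: eq_bigr => alpha /eqP ca.
rewrite -big_mkcond /= sumr_const mulr_natl; congr (_ *+ _).
have := cardC (mem alpha); rewrite card_ord ca => E.
by apply/eqP; rewrite -(eqn_add2l p) subnKC//; apply/eqP.
Qed.

(** [G G W = 0] implies [(G W)* (G W) = 0] and so [G W = 0]. *)
Lemma herm_pow_eq0 p q (Y : 'M[H]_(n, q)) : G ^+ p *m Y = 0 -> G *m Y = 0.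
Proof.
have GG (W : 'M[H]_(n, q)) : G *m (G *m W) = 0 -> G *m W = 0.
  move=> GGW; apply: adjq_mul_eq0; rewrite adjqM GH -mulmxA GGW; exact: mulmx0.
elim: p => [|p IH]; first by rewrite expr0 mul1mx => ->; rewrite mulmx0.
case: p IH => [|p] IH; first by rewrite expr1.
rewrite 2!exprS -!mulmxA => /GG GY; apply: IH; by rewrite exprS -mulmxA.
Qed.

Lemma minorsum0 : minorsum 0 = 1.
Proof.
rewrite /minorsum (big_pred1 set0) ?canon_det0// => alpha.
by rewrite cards_eq0.
Qed.

(** [rho] is the largest order with a nonzero sum of minors.  Beyond it the
    recursion [adjmx_rec] is multiplication by [- G], and it ends in zero; so a
    power of [G] kills [adjmx rho.+1], and then [G] does. *)
Lemma hermitian_projection : exists rho : nat,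
  [/\ minorsum rho != 0, G *m G *m adjmx rho = minorsum rho *: G &
      retrace (G *m adjmx rho) = rho%:R * qre (minorsum rho)].
Proof.
have ex0 : exists p, minorsum p != 0 by exists 0%N; rewrite minorsum0 oner_neq0.
have ubn p : minorsum p != 0 -> (p <= n)%N.
  apply: contraNT; rewrite -ltnNge => np; rewrite /minorsum big_pred0// => alpha.
  apply/negbTE/negP => /eqP ca; have := max_card (mem alpha).
  by rewrite ca card_ord leqNgt np.
case: (ex_maxnP ex0 ubn) => rho drho rmax; exists rho.
have rn := ubn _ drho.
split=> //.
  have pw p : G ^+ p *m adjmx rho.+1 = (-1) ^+ p *: adjmx (rho.+1 + p)%N.
    elim: p => [|p IH]; first by rewrite !expr0 mul1mx scale1r addn0.
    rewrite exprS -mulmxA [G ^+ p *m _]IH addnS [adjmx (_ + _).+1]adjmx_rec.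
    have -> : minorsum (rho.+1 + p)%N = 0.
      by apply/eqP; apply/negPn/negP => /rmax; rewrite leqNgt addSn ltnS leq_addr.
    rewrite scalemx_realAr ?conjq_sign// raddf0 sub0r exprS mulN1r scaleNr scalerN opprK//.
  have : G *m adjmx rho.+1 = 0.
    apply: (@herm_pow_eq0 n); rewrite pw adjmx_big ?scaler0//.
    by rewrite addSn ltnS leq_addl.
  rewrite adjmx_rec mulmxBr mul_mx_real ?minorsum_real// => /eqP.
  by rewrite subr_eq0 => /eqP ->; rewrite mulmxA.
have -> : G *m adjmx rho = (minorsum rho)%:M - adjmx rho.+1.
  by rewrite adjmx_rec opprB addrC subrK.
have -> : retrace ((minorsum rho)%:M - adjmx rho.+1) =
   n%:R * qre (minorsum rho) - retrace (adjmx rho.+1).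
  rewrite /retrace mulr_natl -[in n in _ *+ n](card_ord n) -sumr_const -sumrB.
  by apply: eq_bigr => i _; rewrite !mxE eqxx mulr1n.
by rewrite retrace_adjmx// -mulrBl natrB//; congr (_ * _); ring.
Qed.

(** Identifies the order [rho] of [hermitian_projection].  The rank is that of a
    matrix [M] with the same column space as [G], expressed by the
    hypotheses on [M], [Z] and [Y]: for [G = B B*] the natural choice is a power of [A]. *)
Lemma minorsum_rank (M : 'M[H]_n) (Z : 'M[H]_n) p :
  G = M *m Z -> (forall Y : 'M[H]_n, Y *m G = G -> Y *m M = M) -> rankq M = p ->
  minorsum p != 0 /\ G *m G *m adjmx p = minorsum p *: G.
Proof.
move=> GMZ GM <-; have [rho [drho GGQ tr]] := hermitian_projection.
suff -> : rankq M = rho by [].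
pose d := minorsum rho.
have dr : conjq d^-1 = d^-1 by apply: conjq_fixV; exact: minorsum_real.
have EG : d^-1 *: (G *m adjmx rho) *m G = G.
  by rewrite -scalemxAl -mulmxA -adjmx_comm mulmxA GGQ scalerA mulVr// scale1r.
have := GM _ EG; rewrite {1}GMZ -mulmxA -scalemx_realAr// => EM.
have := retrace_projection EM; rewrite scalemx_realAr// mulmxA -GMZ.
have -> : retrace (d^-1 *: (G *m adjmx rho)) = rho%:R.
  have -> : retrace (d^-1 *: (G *m adjmx rho)) = qre d^-1 * retrace (G *m adjmx rho).
    rewrite /retrace mulr_sumr; apply: eq_bigr => i _; rewrite mxE.
    by rewrite {1}(conjq_fixE dr) mulqE /=; ring.
  have dd : qre d^-1 * qre d = 1.
    transitivity (qre (d^-1 * d)); last by rewrite mulVr.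
    by rewrite {2}(conjq_fixE dr) mulqE /=; ring.
  by rewrite tr mulrCA -/d dd mulr1.
by move/eqP; rewrite eqr_nat => /eqP.
Qed.

End HermitianAdjugate.

(** * Drazin inverses as ratios of determinant sums *)

Section DrazinRepresentations.
Variables (R : realFieldType) (n : nat).
Local Notation H := (quat R).

(** From [Y B B* = 0] one gets [(Y B) (Y B)* = 0]. *)
Lemma mulmx_adjq_eq0 p q (Y : 'M[H]_(p, n)) (B : 'M[H]_(n, q)) :
  Y *m (B *m adjq B) = 0 -> Y *m B = 0.
Proof.
move=> YBB; rewrite -[LHS]adjqK (_ : adjq (Y *m B) = 0).
  by apply/matrixP => a c; rewrite !mxE conjq0.
by apply: adjq_mul_eq0; rewrite adjqK adjqM -mulmxA [B *m _]mulmxA mulmxA YBB mul0mx.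
Qed.

Lemma hermitianq_exp (A : 'M[H]_n) p : hermitianq A -> hermitianq (A ^+ p).
Proof.
rewrite /hermitianq => AH; elim: p => [|p IH].
  apply/matrixP => i j; rewrite expr0 !mxE eq_sym.
  by case: (_ == _); rewrite ?conjq1 ?conjq0.
by rewrite [in LHS]exprSr adjqM AH IH exprS.
Qed.

(** Cramer numerators, summed over all index sets, are the entries of a row
    vector times the summed adjugate. *)
Lemma rdet_sum_adjmx (G : 'M[H]_n) p (c : 'rV[H]_n) i : hermitianq G ->
  \sum_(alpha : {set 'I_n} | (#|alpha| == p) && (i \in alpha))
      rdet_on alpha i (repl_row G i c) = (c *m adjmx G p) 0 i.
Proof.
move=> GH; rewrite mxE; under [RHS]eq_bigr => j _ do rewrite mxE mulr_sumr.
rewrite exchange_big; apply: eq_bigr => alpha /andP[_ ia].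
by rewrite (rdet_on_repl_cofactor _ _ ia).
Qed.

Lemma pminor_sum (G : 'M[H]_n) p : hermitianq G ->
  \sum_(alpha : {set 'I_n} | #|alpha| == p) pminor alpha G = minorsum G p.
Proof. by move=> GH; apply: eq_bigr => alpha _; exact: pminor_canon. Qed.

Lemma drazin_absorbl (S : pzRingType) (a x : S) p :
  x * a * x = x -> a * x = x * a -> x ^+ p.+1 * a ^+ p = x.
Proof.
move=> xax ax; elim: p => [|p IH]; first by rewrite expr0 expr1 mulr1.
by rewrite exprS [a ^+ _]exprSr -mulrA [x ^+ p.+1 * _]mulrA IH -ax mulrA.
Qed.

Lemma drazin_absorbr (S : pzRingType) (a x : S) k p :
  a ^+ k.+1 * x = a ^+ k -> a ^+ (k + p) * x ^+ p = a ^+ k.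
Proof.
move=> akx; elim: p => [|p IH]; first by rewrite addn0 expr0 mulr1.
rewrite addnS -addSn addnC exprD [x ^+ _]exprS -mulrA [a ^+ k.+1 * _]mulrA akx.
by rewrite -[in RHS]IH [in RHS]addnC exprD -mulrA.
Qed.

Variables (A AD : 'M[H]_n) (k : nat) (b : 'rV[H]_n).
Hypothesis dz : is_drazin A k AD.

Let xax : AD * A * AD = AD. Proof. by case: dz. Qed.
Let axC : A * AD = AD * A. Proof. by case: dz. Qed.
Let akx : A ^+ k.+1 * AD = A ^+ k. Proof. by case: dz. Qed.
Let powC p q : A ^+ p * AD ^+ q = AD ^+ q * A ^+ p.
Proof. exact/commrX/commr_sym/commrX/commr_sym. Qed.

(** With [G = A^(k+1)], the row [y = b A^m AD] satisfies
    [y G = b A^(k+m)], and [y = z G] because [AD = AD^(k+2) A^(k+1)].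
    Hence [b A^(k+m) Q = z G G Q = d y]. *)
Lemma hermitian_drazin_rdet r m i : hermitianq A ->
  rankq (A ^+ k.+1) = r -> Rherm A b k r m i = (b *m A ^+ m *m AD) 0 i.
Proof.
move=> AH rA; set G := A ^+ k.+1.
have GH : hermitianq G by exact: hermitianq_exp.
have [|||d0 GGQ] := @minorsum_rank _ _ _ GH G 1 r => //; first by rewrite mulmx1.
rewrite /Rherm rdet_sum_adjmx// pminor_sum// -/G.
pose z := b *m (A ^+ m * AD ^+ k.+2).
have zG : z *m G = b *m A ^+ m *m AD.
  rewrite -[RHS]mulmxA /z -[LHS]mulmxA; congr (_ *m _).
  by rewrite -[LHS]/(A ^+ m * _ * G) -mulrA drazin_absorbl.
have -> : b *m A ^+ (k + m) = z *m G *m G.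
  rewrite zG -[RHS]mulmxA -[RHS]mulmxA; congr (_ *m _).
  rewrite -[RHS]/(A ^+ m * (AD * G)) addnC exprD; congr (_ * _).
  by rewrite -[AD]expr1 -powC expr1.
rewrite -[_ *m _ *m G]mulmxA -mulmxA GGQ scalemx_realAr ?minorsum_real// zG.
by rewrite mxE (conjq_fix_comm _ (minorsum_real GH r)) -mulrA divrr ?mulr1.
Qed.

(** Drazin inverses are reached through [G = B B*] with [B = A^(2k+1)], where
    [A^k = B AD^(k+1) = AD^(k+1) B]: matrices [A^k] and [G] have the same
    column space, and a row [w] with [w G = b A^(k+m) B*] has
    [w B = b A^(k+m)]. *)
Lemma general_drazin_rdet r m i :
  rankq (A ^+ k) = r -> Rgen A b k r m i = (b *m A ^+ m *m AD) 0 i.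
Proof.
move=> rA; rewrite /Rgen; set B := A ^+ (2 * k).+1; set G := B *m adjq B.
have GH : hermitianq G by rewrite /hermitianq /G adjqM adjqK.
have BZ : B = A ^+ k * A ^+ k.+1 by rewrite /B -exprD mul2n -addnn addnS.
have BX : B * AD ^+ k.+1 = A ^+ k.
  rewrite /B mul2n -addnn -addnS; exact: drazin_absorbr.
have AkE : A ^+ k = AD ^+ k.+1 * B by rewrite -BX [in LHS]/B powC.
have [|||d0 GGQ] := @minorsum_rank _ _ _ GH (A ^+ k) (A ^+ k.+1 *m adjq B) r => //.
- by rewrite mulmxA -/(A ^+ k * A ^+ k.+1) -BZ.
- move=> Y YG; apply/eqP; rewrite -subr_eq0 -{2}[A ^+ k]mul1mx -mulmxBl.
  have YB : (Y - 1%:M) *m B = 0.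
    by apply: mulmx_adjq_eq0; rewrite -/G mulmxBl mul1mx YG subrr.
  by rewrite -BX mulmxA YB mul0mx.
set d := b *m A ^+ (k + m) *m adjq B.
(* [w] is the row of inner ratios; [b'] is another solution of [w G = d]. *)
pose w := (minorsum G r)^-1 *: (d *m adjmx G r).
pose b' := b *m A ^+ m *m AD ^+ k.+1.
have dE : d = b' *m G.
  rewrite /d /b' /G !mulmxA; congr (_ *m _); rewrite -!mulmxA; congr (_ *m _).
  by rewrite -/(A ^+ m * (AD ^+ k.+1 * B)) -AkE -exprD addnC.
have dr : conjq (minorsum G r)^-1 = (minorsum G r)^-1.
  exact: conjq_fixV (minorsum_real GH r).
have wG : w *m G = b' *m G.
  have GQG : G *m adjmx G r *m G = minorsum G r *: G.
    by rewrite -[LHS]mulmxA -adjmx_comm// mulmxA GGQ.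
  rewrite /w -scalemxAl dE -[b' *m G *m _]mulmxA -[b' *m _ *m G]mulmxA GQG.
  by rewrite scalemx_realAr ?minorsum_real// scalerA mulVr// scale1r.
have wB : w *m B = b' *m B.
  apply/eqP; rewrite -subr_eq0 -mulmxBl; apply/eqP/mulmx_adjq_eq0.
  by rewrite -/G mulmxBl wG subrr.
transitivity ((w *m A ^+ k) 0 i); last first.
  rewrite -BX mulmxA wB /b' -!mulmxA; congr ((_ *m (_ *m _)) _ _).
  rewrite -/(AD ^+ k.+1 * (B * AD ^+ k.+1)) BX; exact: drazin_absorbl.
rewrite mxE mulr_suml; apply: eq_bigr => s _.
rewrite rdet_sum_adjmx// pminor_sum// [w 0 s]mxE.
by rewrite -(conjq_fix_comm _ dr) mulrA.
Qed.

End DrazinRepresentations.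

(** * Polynomial solution of the system *)

From mathcomp Require Import all_classical all_reals all_analysis.
Import numFieldNormedType.Exports.

Lemma qrealM (R : realFieldType) (a c : R) : qreal (a * c) = qreal a * qreal c.
Proof. by rewrite mulqE /qreal /Defs.mulq /=; congr Quat; ring. Qed.

Section TaylorPolynomial.
Variable R : realType.
Local Notation H := (quat R).

Lemma is_derive_taylor (c : R) (w : nat -> R) k (t : R) :
  is_derive t (1 : R)
    (fun u => c + \sum_(1 <= m < k.+1) (m`!%:R)^-1 * u ^+ m * w m)
    (\sum_(m < k) (m`!%:R)^-1 * t ^+ m * w m.+1).
Proof.
elim: k => [|k IH].
  rewrite big_ord0 (_ : (fun u => _) = cst c); first exact: is_derive_cst.
  by apply/funext => u; rewrite big_geq// addr0.
rewrite big_ord_recr /= (_ : (fun u => _) =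
  (fun u => c + \sum_(1 <= m < k.+1) (m`!%:R)^-1 * u ^+ m * w m) +
  ((k.+1`!%:R)^-1 * w k.+1) *: (id ^+ k.+1)); last first.
  apply/funext => u; by rewrite big_nat_recr//= addrA mulrAC exprfctE.
apply: is_deriveD; apply: is_derive_eq.
have fk : (k`!%:R : R) != 0 by rewrite pnatr_eq0 -lt0n fact_gt0.
have k1 : (k.+1%:R : R) != 0 by rewrite pnatr_eq0.
rewrite /GRing.scale /= factS natrM mulr1; field; exact/andP.
Qed.

(** The four components are additive and commute with real factors, so they
    are handled together. *)
Lemma is_derive_quat_taylor (c : H) (w : nat -> H) k (t : R) :
  is_derive_quat
    (fun u => c + \sum_(1 <= m < k.+1) qreal ((m`!%:R)^-1 * u ^+ m) * w m) t
    (\sum_(m < k) qreal ((m`!%:R)^-1 * t ^+ m) * w m.+1).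
Proof.
have key (f : H -> R) : {morph f : x y / x + y} ->
    (forall a x, f (qreal a * x) = a * f x) ->
    is_derive t (1 : R)
      (fun u => f (c + \sum_(1 <= m < k.+1) qreal ((m`!%:R)^-1 * u ^+ m) * w m))
      (f (\sum_(m < k) qreal ((m`!%:R)^-1 * t ^+ m) * w m.+1)).
  move=> fD fZ; have f0 : f 0 = 0 by rewrite -(mul0r (0 : H)) (fZ 0) mul0r.
  have fS := big_morph f fD f0.
  rewrite fS (_ : (fun u => _) = (fun u => f c + \sum_(1 <= m < k.+1)
     (m`!%:R)^-1 * u ^+ m * f (w m))).
    under eq_bigr do rewrite fZ.
    exact: (is_derive_taylor (f c) (f \o w)).
  by apply/funext => u; rewrite fD fS; under eq_bigr do rewrite fZ.
by split; apply: key => // a x; rewrite mulqE /=; ring.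
Qed.

End TaylorPolynomial.

Unset Implicit Arguments.

Theorem theorem3p17 (R : realType) (n k r : nat) (A AD : 'M[quat R]_n)
    (b : 'rV[quat R]_n) (X : R -> 'rV[quat R]_n)
    (Ak : is_index A k)
    (rAk1 : rankq (A ^+ k.+1) = r) (rAk : rankq (A ^+ k) = r)
    (AD_drazin : is_drazin A k AD)
    (XE : forall t : R,
       X t = - (b *m AD) +
         \sum_(1 <= m < k.+1)
            qreal ((m`!%:R)^-1 * t ^+ m) *:
              (b *m A ^+ m.-1 - b *m A ^+ m *m AD)) :
  [/\ solves_system A b X,
      hermitianq A ->
        forall (t : R) (i : 'I_n),
          X t 0 i = - Rherm A b k r 0 i +
            \sum_(1 <= m < k.+1)
               qreal (m`!%:R)^-1 * ((b *m A ^+ m.-1) 0 i - Rherm A b k r m i) *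
                 qreal (t ^+ m)
    & forall (t : R) (i : 'I_n),
        X t 0 i = - Rgen A b k r 0 i +
          \sum_(1 <= m < k.+1)
             qreal (m`!%:R)^-1 * ((b *m A ^+ m.-1) 0 i - Rgen A b k r m i) *
               qreal (t ^+ m)].
Proof.
(* The coefficients of [X]; [A] shifts them, and [v k.+1 = 0] by the index. *)
pose v m : 'rV[quat R]_n := b *m A ^+ m.-1 - b *m A ^+ m *m AD.
have [_ axC akx] := AD_drazin.
have vA m : (0 < m)%N -> v m *m A = v m.+1.
  case: m => // m _; rewrite /v /= mulmxBl.
  have powS p : b *m A ^+ p *m A = b *m A ^+ p.+1 by rewrite exprSr mulmxA.
  by rewrite powS -[_ *m AD *m A]mulmxA -axC mulmxA powS.
have vk : v k.+1 = 0 by rewrite /v /= -[b *m _ *m AD]mulmxA [_ *m AD]akx subrr.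
have v1 : - (b *m AD) *m A + b = v 1%N.
  by rewrite /v /= expr0 expr1 mulmx1 mulNmx -[b *m AD *m A]mulmxA -axC mulmxA addrC.
(* [S m] stands for either expression of the [i]th entry of [b A^m AD]. *)
have entry t i (S : nat -> quat R) :
    (forall m, (b *m A ^+ m *m AD) 0 i = S m) ->
    X t 0 i = - S 0%N + \sum_(1 <= m < k.+1)
      qreal (m`!%:R)^-1 * ((b *m A ^+ m.-1) 0 i - S m) * qreal (t ^+ m).
  move=> SE; rewrite XE mxE summxE mxE -SE expr0 mulmx1; congr (_ + _).
  apply: eq_bigr => m _; rewrite [LHS]mxE -SE qrealM.
  by rewrite -mulrA [qreal (t ^+ m) * _]qreal_comm mulrA; congr (_ * _ * _); rewrite !mxE.
split.
- move=> t i.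
  have -> : (fun u => X u 0 i) = (fun u => - (b *m AD) 0 i +
      \sum_(1 <= m < k.+1) qreal ((m`!%:R)^-1 * u ^+ m) * v m 0 i).
    apply/funext => u; rewrite XE mxE summxE mxE; congr (_ + _).
    by apply: eq_bigr => m _; rewrite mxE.
  have -> : (X t *m A + b) 0 i =
      \sum_(m < k) qreal ((m`!%:R)^-1 * t ^+ m) * v m.+1 0 i.
    have -> : X t *m A + b =
        \sum_(0 <= m < k.+1) qreal ((m`!%:R)^-1 * t ^+ m) *: v m.+1.
      rewrite big_nat_recl// XE mulmxDl addrAC v1 fact0 invr1 mul1r expr0.
      rewrite scale1r; congr (_ + _).
      rewrite big_add1 /= mulmx_suml; apply: eq_bigr => m _.
      by rewrite -scalemxAl -/(v m.+1) vA.
    rewrite big_nat_recr//= vk scaler0 addr0 summxE big_mkord.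
    by apply: eq_bigr => m _; rewrite mxE.
  exact: (is_derive_quat_taylor _ (fun m => v m 0 i)).
- by move=> AH t i; apply: entry => m; rewrite (hermitian_drazin_rdet _ AD_drazin).
- by move=> t i; apply: entry => m; rewrite (general_drazin_rdet _ AD_drazin).
Qed.
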